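(* Let $A\in M_d(\mathbb C)^g$ and suppose $\mathcal D_A$ is bounded. (i) If $t>1$, then there exists a matrix-valued free analytic polynomial $Q$ such that $\mathcal D_A\subseteq\mathcal G_Q\subseteq t\,\mathcal D_A$. (ii) If $\mathcal G_Q$ is a free pseudoconvex set and $\mathcal D_A\subseteq\mathcal G_Q$, then there is an $s>1$ such that $\mathcal D_A\subseteq K_{sQ}$. (iii) If $p$ is a free rational function analytic on $\mathcal D_A$, then there is a $t>1$ such that $p$ is analytic and bounded on $t\,\mathcal D_A$.
   Context: For $A\in M_d(\mathbb C)^g$ and freely noncommuting variables $x=(x_1,\dots,x_g)$ put $\Lambda_A(x)=\sum_jA_jx_j$ and $L_A(X)=I+\sum_jA_j\otimes X_j+\big(\sum_jA_j\otimes X_j\big)^*$ for $X\in M_n(\mathbb C)^g$. $\mathcal D_A=(\mathcal D_A(n))_n$, $\mathcal D_A(n)=\{X\in M_n(\mathbb C)^g:L_A(X)\succeq0\}$; it is bounded if there is $N$ with $\|X\|\le N$ for all $n$ and all $X\in\mathcal D_A(n)$. $t\mathcal D_A=\{tX:X\in\mathcal D_A\}$ levelwise. Inclusions are levelwise. A free analytic polynomial is a polynomial in the freely noncommuting variables $x_1,\dots,x_g$ only (no adjoints); a matrix-valued one $Q=\sum_wQ_ww$ is evaluated at $X\in M_n(\mathbb C)^g$ by $Q(X)=\sum_wQ_w\otimes w(X)$. For such $Q$, the free pseudoconvex set it defines is $\mathcal G_Q=\{X:\|Q(X)\|<1\}$ (over all sizes $n$), and for $s>1$, $K_{sQ}=\{X:s\|Q(X)\|\le1\}$.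 A free rational function regular at $0$ is an expression $r(x)=c^*(I-\Lambda_E(x))^{-1}b$ with $E\in M_m(\mathbb C)^g$, $b,c\in\mathbb C^m$. When $m$ is minimal among all such representations of $r$, the singularity set of $r$ is $\{X:\det(I-\Lambda_E(X))=0\}$; $r$ is analytic on a set if that set contains no singularities of $r$. Bounded means norms of values are uniformly bounded over all sizes. *)

(* Defs.v *)
From HB Require Import structures.
From mathcomp Require Import all_boot all_order all_algebra.
From mathcomp Require Import finmap.
From mathcomp Require Import all_classical all_reals.
From mathcomp Require Import complex mxtens.

Set Implicit Arguments.
Unset Strict Implicit.
Unset Printing Implicit Defensive.

Import Order.TTheory GRing.Theory Num.Theory.
Local Open Scope ring_scope.
Local Open Scope complex_scope.
Local Open Scope classical_set_scope.

Section MatrixNotions.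
Variable R : realType.
Local Notation C := R[i].

Definition adjmx m n (M : 'M[C]_(m, n)) : 'M[C]_(n, m) :=
  map_mx (@conjc R) M^T.

(* Over the complex numbers, positivity of the quadratic form forces M to be
   self-adjoint; 0 <= z in R[i] means that z is real and nonnegative. *)
Definition psdmx n (M : 'M[C]_n) : Prop :=
  forall v : 'cV[C]_n, 0 <= (adjmx v *m M *m v) 0 0.

Definition vnorm n (v : 'cV[C]_n) : R :=
  Num.sqrt (\sum_(i < n) ComplexField.Normc.normc (v i 0) ^+ 2).

Definition opnorm m n (M : 'M[C]_(m, n)) : R :=
  sup [set vnorm (M *m v) | v in [set v : 'cV[C]_n | vnorm v <= 1]].

End MatrixNotions.

Section FreeSets.
Variables (R : realType) (g : nat).
Local Notation C := R[i].

Definition mxtuple n := 'I_g -> 'M[C]_n.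

Definition tupnorm n (X : mxtuple n) : R :=
  \big[Num.max/0]_(j < g) opnorm (X j).

(* Level 0 is allowed but carries no information: its only tuple, of empty
   matrices, has norm 0, lies in every spectrahedron and every set ||Q|| < 1, and
   is never a singularity. *)
Definition freeset := forall n : nat, set (mxtuple n).

Definition free_subset (S T : freeset) : Prop := forall n, S n `<=` T n.

Definition free_scale (t : R) (S : freeset) : freeset :=
  fun n => [set (fun j => t%:C *: X j) | X in S n].

Definition free_bounded (S : freeset) : Prop :=
  exists N : R, forall n (X : mxtuple n), S n X -> tupnorm X <= N.

Definition LambdaX d (A : mxtuple d) n (X : mxtuple n) : 'M[C]_(d * n) :=
  \sum_(j < g) (A j *t X j).

Definition LX d (A : mxtuple d) n (X : mxtuple n) : 'M[C]_(d * n) :=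
  1%:M + LambdaX A X + adjmx (LambdaX A X).

Definition spectrahedron d (A : mxtuple d) : freeset :=
  fun n => [set X | psdmx (LX A X)].

(* A k x l matrix-valued free analytic polynomial is the finitely supported
   family of its coefficients, indexed by the words in the g variables. *)
Definition freepoly k l := {fsfun seq 'I_g -> 'M[C]_(k, l) with 0}.

Definition word_eval n (X : mxtuple n) (w : seq 'I_g) : 'M[C]_n :=
  \prod_(j <- w) X j.

Definition poly_eval k l (Q : freepoly k l) n (X : mxtuple n) :
    'M[C]_(k * n, l * n) :=
  \sum_(w <- finsupp Q) (Q w *t word_eval X w).

Definition pseudoconvex k l (Q : freepoly k l) : freeset :=
  fun n => [set X | opnorm (poly_eval Q X) < 1].

Definition Kset k l (s : R) (Q : freepoly k l) : freeset :=
  fun n => [set X | s * opnorm (poly_eval Q X) <= 1].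

(* The expression c^* (I - Lambda_E(x))^{-1} b. *)
Record ratexpr := RatExpr {
  rdim : nat;
  rE : mxtuple rdim;
  rb : 'cV[C]_rdim;
  rc : 'cV[C]_rdim }.

Definition rpencil (r : ratexpr) n (X : mxtuple n) : 'M[C]_(rdim r * n) :=
  1%:M - LambdaX (@rE r) X.

(* The value, of size 1 * n, is meaningful only where rpencil is invertible. *)
Definition reval (r : ratexpr) n (X : mxtuple n) : 'M[C]_(1 * n) :=
  (adjmx (rc r) *t 1%:M) *m invmx (rpencil r X) *m (rb r *t 1%:M).

(* Two expressions represent the same rational function when their values agree
   wherever both are defined. *)
Definition same_ratfun (r q : ratexpr) : Prop :=
  forall n (X : mxtuple n), \det (rpencil r X) != 0 ->
    \det (rpencil q X) != 0 -> reval r X = reval q X.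

Definition minimal_realization (r q : ratexpr) : Prop :=
  same_ratfun r q /\
  forall q' : ratexpr, same_ratfun r q' -> (rdim q <= rdim q')%N.

Lemma minimal_realization_exists (r : ratexpr) :
  exists q, minimal_realization r q.
Proof.
have ex : exists m, `[< exists2 q, same_ratfun r q & rdim q = m >].
  by exists (rdim r); apply/asboolP; exists r.
case: (ex_minnP ex) => m /asboolP[q rq qm] min; exists q; split=> // q' rq'.
by rewrite qm; apply: min; apply/asboolP; exists q'.
Qed.

(* Minimal realizations of r are pairwise similar, so that neither the
   singularity set nor the values below depend on the choice of q. *)
Definition singularity_set (r : ratexpr) : freeset :=
  fun n => [set X | exists2 q, minimal_realization r q &
                      \det (rpencil q X) = 0].

Definition analytic_on (r : ratexpr) (S : freeset) : Prop :=
  forall n (X : mxtuple n), S n X -> ~ singularity_set r X.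

Definition rat_bounded_on (r : ratexpr) (S : freeset) : Prop :=
  exists M : R, forall q, minimal_realization r q ->
    forall n (X : mxtuple n), S n X -> opnorm (reval q X) <= M.

End FreeSets.

(* Main.v *)
Require Import Defs.
From mathcomp Require Import all_boot all_order all_algebra.
From mathcomp Require Import finmap.
From mathcomp Require Import all_classical all_reals.
From mathcomp Require Import complex mxtens.
From mathcomp Require Import topology normedtype derive.
From mathcomp Require Import ring lra zify.

(** Part (i) is explicit.  Membership in [D_A] says that the numerical range of
    [Lambda_A(X)] lies in the half-plane [Re z >= -1/2], and on a bounded spectrahedron
    a half-plane can be traded for a large disc: for [rho] large enough the affine
    polynomial [Q = (Lambda_A - rho) / r] with [r^2 = rho^2 + t rho] satisfies
    [D_A <= G_Q <= t D_A] ([pseudoconvex_between]).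

    Parts (ii) and (iii) rest on one uniformity principle ([attained_extrema]): for a
    matrix polynomial [P], the numbers [|P(X) v|^2], with [X] in [D_A] of any size and
    [v] a unit vector, have a minimum and a maximum.  Indeed [P(X) v] only involves
    boundedly many vectors [w(X) v_i], and compressing [X] to their span preserves
    both membership in [D_A] and [P(X) v] ([compression]); so every value is attained
    at one fixed size, where [D_A] is compact ([compact_levelset]).

    For (ii), all the values for [P = Q] are less than 1, hence so is their maximum.
    For (iii), take a minimal realization [(c, E, b)] of [p] and [P = I - Lambda_E]: the
    values are positive, hence bounded below by some [e > 0].  As [Lambda_E] is bounded
    on [D_A], a slightly smaller lower bound persists on [t D_A] for [t] close to 1
    ([pencil_uniform]), which gives both invertibility of the pencil and a uniform
    bound on its inverse, hence on [p].

    Analyticity and boundedness are required of all minimal realizations of [p] at once.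
    This reduces to a single one by the state space isomorphism theorem
    ([minimal_similar]): the values of a realization determine the coefficients
    [c^* E^w b], as evaluation at nilpotent shifts shows ([same_ratfun_coef]), and are
    determined by them ([coef_same_ratfun]); so a minimal realization is controllable
    and observable, and two of them with the same coefficients are similar. *)

Set Implicit Arguments.
Unset Strict Implicit.
Unset Printing Implicit Defensive.

Import Order.TTheory GRing.Theory Num.Theory.
Import numFieldNormedType.Exports.
Local Open Scope ring_scope.
Local Open Scope complex_scope.

Local Notation Re := complex.Re.
Local Notation Im := complex.Im.

(** * Adjoints and the Hilbert-Schmidt norm *)

Section Adjoint.
Variable R : realType.
Local Notation C := R[i].

Lemma adjmxE m n (M : 'M[C]_(m, n)) i j : adjmx M i j = conjc (M j i).
Proof. by rewrite !mxE. Qed.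

Lemma adjmxM m n p (A : 'M[C]_(m, n)) (B : 'M[C]_(n, p)) :
  adjmx (A *m B) = adjmx B *m adjmx A.
Proof. by rewrite /adjmx trmx_mul map_mxM. Qed.

Lemma adjmxB m n (A B : 'M[C]_(m, n)) : adjmx (A - B) = adjmx A - adjmx B.
Proof. by rewrite /adjmx linearB map_mxB. Qed.

Lemma adjmxK m n (A : 'M[C]_(m, n)) : adjmx (adjmx A) = A.
Proof. by apply/matrixP => i j; rewrite !adjmxE conjcK. Qed.

Lemma adjmx1 n : adjmx (1%:M : 'M[C]_n) = 1%:M.
Proof. by rewrite /adjmx trmx1 map_mx1. Qed.

Lemma adjmxZ m n a (A : 'M[C]_(m, n)) : adjmx (a *: A) = conjc a *: adjmx A.
Proof. by rewrite /adjmx linearZ map_mxZ. Qed.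

Lemma adjmx0 m n : adjmx (0 : 'M[C]_(m, n)) = 0.
Proof. by rewrite /adjmx trmx0 map_mx0. Qed.

Lemma adjmx_tens m n p q (A : 'M[C]_(m, n)) (B : 'M[C]_(p, q)) :
  adjmx (A *t B) = adjmx A *t adjmx B.
Proof. by rewrite /adjmx trmx_tens map_mxT. Qed.

Lemma adjmx_row m n p (A : 'M[C]_(m, n)) (B : 'M[C]_(m, p)) :
  adjmx (row_mx A B) = col_mx (adjmx A) (adjmx B).
Proof. by rewrite /adjmx tr_row_mx map_col_mx. Qed.

(** The squared Hilbert-Schmidt norm, kept real-valued so that the estimates below
    stay in the ordered field [R]; on column vectors it is the squared Euclidean
    norm. *)
Definition sqnorm m n (Z : 'M[C]_(m, n)) : R :=
  \sum_i \sum_j (Re (Z i j) ^+ 2 + Im (Z i j) ^+ 2).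

Lemma sqnormE m n (Z : 'M[C]_(m, n)) : (sqnorm Z)%:C = \tr (adjmx Z *m Z).
Proof.
rewrite /sqnorm /mxtrace exchange_big /= raddf_sum; apply: eq_bigr => j _ /=.
rewrite mxE raddf_sum; apply: eq_bigr => i _.
rewrite adjmxE; case: (Z i j) => a b /=; simpc.
by apply/eqP; rewrite eq_complex /=; apply/andP; split; apply/eqP; ring.
Qed.

Lemma sqnorm_ge0 m n (Z : 'M[C]_(m, n)) : 0 <= sqnorm Z.
Proof.
by apply: sumr_ge0 => i _; apply: sumr_ge0 => j _; rewrite addr_ge0 ?sqr_ge0.
Qed.

Lemma sqnorm0 m n : sqnorm (0 : 'M[C]_(m, n)) = 0.
Proof.
by rewrite /sqnorm big1 // => i _; rewrite big1 // => j _; rewrite mxE /= expr0n addr0.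
Qed.

Lemma sqnorm_eq0 m n (Z : 'M[C]_(m, n)) : sqnorm Z = 0 -> Z = 0.
Proof.
move/eqP; rewrite psumr_eq0; last first.
  by move=> i _; apply: sumr_ge0 => j _; rewrite addr_ge0 ?sqr_ge0.
move/allP=> h; apply/matrixP => i j; rewrite mxE.
have := h i (mem_index_enum i); rewrite /= psumr_eq0; last first.
  by move=> k _; rewrite addr_ge0 ?sqr_ge0.
move/allP/(_ j (mem_index_enum j)); rewrite /= paddr_eq0 ?sqr_ge0 // !sqrf_eq0.
by case/andP=> /eqP a0 /eqP b0; apply/eqP; rewrite eq_complex a0 b0 /= eqxx.
Qed.

Lemma sqnorm_tr m n (Z : 'M[C]_(m, n)) : sqnorm Z^T = sqnorm Z.
Proof.
by rewrite /sqnorm exchange_big; apply: eq_bigr=> i _; apply: eq_bigr => j _; rewrite mxE.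
Qed.

Lemma sqnormZ m n (a : C) (Z : 'M[C]_(m, n)) :
  sqnorm (a *: Z) = (Re a ^+ 2 + Im a ^+ 2) * sqnorm Z.
Proof.
rewrite /sqnorm mulr_sumr; apply: eq_bigr => i _; rewrite mulr_sumr; apply: eq_bigr => j _.
by rewrite mxE; case: a; case: (Z i j) => b c x y /=; ring.
Qed.

Lemma sqnormZr m n (a : R) (Z : 'M[C]_(m, n)) : sqnorm (a%:C *: Z) = a ^+ 2 * sqnorm Z.
Proof. by rewrite sqnormZ /= expr0n addr0. Qed.

(** The parallelogram law, minus one square: a substitute for the triangle
    inequality that needs no square roots, its constants being harmless below. *)
Lemma sqnormD_le m n (Y Z : 'M[C]_(m, n)) : sqnorm (Y + Z) <= 2 * sqnorm Y + 2 * sqnorm Z.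
Proof.
rewrite /sqnorm !mulr_sumr -big_split; apply: ler_sum => i _ /=.
rewrite !mulr_sumr -big_split; apply: ler_sum => j _ /=.
rewrite mxE; case: (Y i j) => a b; case: (Z i j) => c e /=.
have := sqr_ge0 (a - c); have := sqr_ge0 (b - e); nra.
Qed.

Lemma sqnorm_entry m n (Z : 'M[C]_(m, n)) i j :
  Re (Z i j) ^+ 2 + Im (Z i j) ^+ 2 <= sqnorm Z.
Proof.
rewrite /sqnorm (bigD1 i) //= (bigD1 j) //= -addrA lerDl addr_ge0 ?sumr_ge0 // => k _.
  by rewrite addr_ge0 ?sqr_ge0.
by apply: sumr_ge0 => k' _; rewrite addr_ge0 ?sqr_ge0.
Qed.

Lemma sqnorm_cols m n (Z : 'M[C]_(m, n)) : sqnorm Z = \sum_j sqnorm (col j Z).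
Proof.
rewrite /sqnorm exchange_big; apply: eq_bigr => j _; apply: eq_bigr => i _.
by rewrite big_ord1 mxE.
Qed.

Lemma vnormE n (v : 'cV[C]_n) : vnorm v = Num.sqrt (sqnorm v).
Proof.
rewrite /vnorm /sqnorm; congr Num.sqrt; apply: eq_bigr => i _; rewrite big_ord1.
by case: (v i 0) => a b /=; rewrite sqr_sqrtr // addr_ge0 ?sqr_ge0.
Qed.

Lemma vnorm_ge0 n (v : 'cV[C]_n) : 0 <= vnorm v.
Proof. exact: sqrtr_ge0. Qed.

Lemma vnorm_sqr n (v : 'cV[C]_n) : vnorm v ^+ 2 = sqnorm v.
Proof. by rewrite vnormE sqr_sqrtr ?sqnorm_ge0. Qed.

Lemma sqnorm_colE n (v : 'cV[C]_n) : (adjmx v *m v) 0 0 = (sqnorm v)%:C.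
Proof. by rewrite sqnormE /mxtrace big_ord1. Qed.

Lemma sqnorm_normalize n (v : 'cV[C]_n) : sqnorm v != 0 ->
  exists2 u : 'cV[C]_n, sqnorm u = 1 & exists a : R, v = a%:C *: u.
Proof.
move=> h0; pose a := Num.sqrt (sqnorm v).
have a0 : a != 0 by rewrite sqrtr_eq0 -ltNge lt0r h0 sqnorm_ge0.
exists ((a^-1)%:C *: v).
  by rewrite sqnormZr -[sqnorm v]sqr_sqrtr ?sqnorm_ge0 // -exprMn mulVf // expr1n.
by exists a; rewrite scalerA -rmorphM /= divff // scale1r.
Qed.

(** The identification of C^l (x) C^n with n x l matrices.  It turns [A *t M] into
    [V |-> M V A^T], so that the two tensor factors act on different sides. *)
Definition unvec l n (v : 'cV[C]_(l * n)) : 'M[C]_(n, l) :=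
  \matrix_(a, i) v (mxtens_index (i, a)) 0.

Definition mkvec l n (V : 'M[C]_(n, l)) : 'cV[C]_(l * n) :=
  \col_k V (mxtens_unindex k).2 (mxtens_unindex k).1.

Lemma mkvecK l n (V : 'M[C]_(n, l)) : unvec (mkvec V) = V.
Proof. by apply/matrixP => a i; rewrite !mxE mxtens_indexK. Qed.

Lemma unvecD l n (v w : 'cV[C]_(l * n)) : unvec (v + w) = unvec v + unvec w.
Proof. by apply/matrixP => a i; rewrite !mxE. Qed.

Lemma unvec0 l n : unvec (0 : 'cV[C]_(l * n)) = 0.
Proof. by apply/matrixP => a i; rewrite !mxE. Qed.

Lemma unvec_sum l n (I : Type) (s : seq I) (F : I -> 'cV[C]_(l * n)) :
  unvec (\sum_(i <- s) F i) = \sum_(i <- s) unvec (F i).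
Proof. exact: (big_morph _ (@unvecD l n) (unvec0 l n)). Qed.

Lemma sum_tens l n (F : 'I_(l * n) -> R) :
  \sum_k F k = \sum_i \sum_a F (mxtens_index (i, a)).
Proof.
rewrite pair_bigA /= (reindex (@mxtens_index l n)) /=; last first.
  exists (@mxtens_unindex l n) => x _; [exact: mxtens_indexK | exact: mxtens_unindexK].
by apply: eq_bigr => -[].
Qed.

Lemma sqnorm_unvec l n (v : 'cV[C]_(l * n)) : sqnorm (unvec v) = sqnorm v.
Proof.
rewrite /sqnorm [RHS](eq_bigr _ (fun i _ => big_ord1 _ _)) sum_tens exchange_big.
by apply: eq_bigr => i _; apply: eq_bigr => a _; rewrite mxE.
Qed.

Lemma unvec_tens k l m n (A : 'M[C]_(k, l)) (M : 'M[C]_(m, n)) v :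
  unvec ((A *t M) *m v) = M *m unvec v *m A^T.
Proof.
apply/matrixP => a i; rewrite !mxE.
under [RHS]eq_bigr => j _ do rewrite mxE mulr_suml.
rewrite pair_bigA /= (reindex (@mxtens_index l n)) /=; last first.
  exists (@mxtens_unindex l n) => x _; [exact: mxtens_indexK | exact: mxtens_unindexK].
apply: eq_bigr => -[j b] _; rewrite tensmxE !mxE /=; ring.
Qed.

End Adjoint.

(** * Compression to a fixed size *)

Section Compression.
Variable R : realType.
Local Notation C := R[i].

Lemma adjmx_col_self n (v : 'cV[C]_n) : adjmx v *m v = ((sqnorm v)%:C)%:M.
Proof. by apply/matrixP => i j; rewrite !ord1 sqnorm_colE mxE eqxx mulr1n. Qed.

(** Gram-Schmidt, where a vector that depends on the preceding ones contributes a
    zero column: the number of columns of [W] is then the number of vectors given,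
    whatever the dimension of their span, and [W^* W] is still a projection. *)
Lemma partial_isometry n (s : seq 'cV[C]_n) K : size s = K ->
  exists W : 'M[C]_(n, K), W *m adjmx W *m W = W /\
    {in s, forall u, W *m adjmx W *m u = u}.
Proof.
elim: s K => [|u s IH] K /= <-.
  by exists 0; rewrite mulmx0; split.
have [W [WWW Ws]] := IH _ erefl.
pose x : 'cV[C]_n := u - W *m adjmx W *m u.
pose w : 'cV[C]_n := ((Num.sqrt (sqnorm x))^-1)%:C *: x.
(* [x] is the part of [u] orthogonal to the preceding vectors; when it vanishes,
   the convention 0^-1 = 0 makes [w] vanish too. *)
have Wx : adjmx W *m x = 0.
  have := congr1 (@adjmx R _ _) WWW; rewrite !adjmxM adjmxK => WWa.
  by rewrite mulmxBr !mulmxA -[adjmx W *m W *m _]mulmxA WWa subrr.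
have Ww : adjmx W *m w = 0 by rewrite -scalemxAr Wx scaler0.
have wW : adjmx w *m W = 0 by rewrite -[W]adjmxK -adjmxM Ww adjmx0.
have wwx : w *m adjmx w *m x = x.
  rewrite -mulmxA /w adjmxZ conjc_real -!scalemxAl -scalemxAr adjmx_col_self.
  rewrite mul_mx_scalar !scalerA.
  have [h0|h0] := eqVneq (sqnorm x) 0.
    by rewrite (sqnorm_eq0 h0) scaler0.
  have h1 : Num.sqrt (sqnorm x) != 0 by rewrite sqrtr_eq0 -ltNge lt0r h0 sqnorm_ge0.
  rewrite -!rmorphM /= -[RHS]scale1r -(rmorph1 (real_complex R)) /=.
  congr (_%:C *: _); rewrite -[X in _ * (_ * X)](sqr_sqrtr (sqnorm_ge0 x)).
  by field.
pose W2 : 'M[C]_(n, 1 + size s) := row_mx w W.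
suff h : W2 *m adjmx W2 *m W2 = W2 /\ {in u :: s, forall y, W2 *m adjmx W2 *m y = y}.
  by exists W2.
rewrite /W2 adjmx_row mul_row_col; split.
  rewrite mul_mx_row; congr row_mx.
    by rewrite mulmxDl -[W *m _ *m w]mulmxA Ww mulmx0 addr0 {2 3}/w -!scalemxAr wwx.
  by rewrite mulmxDl -[w *m _ *m W]mulmxA wW mulmx0 add0r.
move=> y; rewrite inE => /predU1P[->|ys].
  rewrite mulmxDl -{1}[u](subrK (W *m adjmx W *m u)) -/x mulmxDr wwx.
  by rewrite !mulmxA -[w *m _ *m W]mulmxA wW mulmx0 !mul0mx addr0 subrK.
by rewrite mulmxDl -{1}(Ws y ys) !mulmxA -[w *m _ *m W]mulmxA wW mulmx0 !mul0mx add0r Ws.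
Qed.

Variable g : nat.

Lemma LX_form d (A : mxtuple R g d) n (X : mxtuple R g n) (v : 'cV[C]_(d * n)) :
  (adjmx v *m LX A X *m v) 0 0 =
  (sqnorm v + 2 * Re ((adjmx v *m LambdaX A X *m v) 0 0))%:C.
Proof.
rewrite rmorphD rmorphM rmorph_nat.
rewrite /LX !mulmxDr !mulmxDl mulmx1 -addrA mxE sqnorm_colE; congr (_ + _).
rewrite mxE.
have -> : (adjmx v *m adjmx (LambdaX A X) *m v) 0 0 = conjc ((adjmx v *m LambdaX A X *m v) 0 0).
  by rewrite -adjmxE !adjmxM adjmxK mulmxA.
by rewrite addcJ.
Qed.

Lemma LambdaX_conj d (A : mxtuple R g d) n (X : mxtuple R g n) m (V : 'M[C]_(m, n))
    (W : 'M[C]_(n, m)) :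
  LambdaX A (fun j => V *m X j *m W) = (1%:M *t V) *m LambdaX A X *m (1%:M *t W).
Proof.
rewrite /LambdaX mulmx_sumr mulmx_suml; apply: eq_bigr => j _.
by rewrite !tensmx_mul mul1mx mulmx1.
Qed.

Lemma tens11 p n : (1%:M : 'M[C]_p) *t (1%:M : 'M[C]_n) = 1%:M.
Proof.
apply/matrixP => i j; case: (mxtens_indexP i) => i1 i2; case: (mxtens_indexP j) => j1 j2.
rewrite tensmxE !mxE (can_eq (@mxtens_indexK _ _)) xpair_eqE.
by do !case: (_ == _); rewrite ?mulr1 ?mulr0.
Qed.

Lemma psdmx_adj n (G : 'M[C]_n) m (M : 'M[C]_m) (B : 'M[C]_(m, n)) :
  psdmx M -> psdmx (adjmx G *m G + adjmx B *m M *m B).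
Proof.
move=> hM v; rewrite mulmxDr mulmxDl mxE addr_ge0 //.
  by rewrite !mulmxA -adjmxM -mulmxA sqnorm_colE ler0c sqnorm_ge0.
by have := hM (B *m v); rewrite adjmxM !mulmxA.
Qed.

(** Since [B] is a partial isometry, the constant term of [LX A] compresses to
    [B^* B], which differs from 1 by the projection [G^* G], [G = 1 - B^* B]:
    [L_A (W^* X W) = G^* G + B^* L_A(X) B] is positive with [L_A(X)]. *)
Lemma spectrahedron_compress d (A : mxtuple R g d) n (X : mxtuple R g n) m (W : 'M[C]_(n, m)) :
  W *m adjmx W *m W = W -> spectrahedron A X ->
  spectrahedron A (fun j => adjmx W *m X j *m W).
Proof.
move=> WWW hX; rewrite /spectrahedron /=.
set B : 'M[C]_(d * n, d * m) := 1%:M *t W.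
have BBB : B *m adjmx B *m B = B.
  by rewrite /B adjmx_tens adjmx1 !tensmx_mul WWW !mulmx1.
have adjT : adjmx (adjmx B *m B) = adjmx B *m B by rewrite adjmxM adjmxK.
have GG : adjmx (1%:M - adjmx B *m B) *m (1%:M - adjmx B *m B) = 1%:M - adjmx B *m B.
  rewrite adjmxB adjmx1 adjT mulmxBl mul1mx mulmxBr mulmx1 mulmxA.
  by rewrite -[adjmx B *m B *m _]mulmxA -[adjmx B *m (_ *m _) *m _]mulmxA BBB subrr subr0.
have -> : LX A (fun j => adjmx W *m X j *m W) =
    adjmx (1%:M - adjmx B *m B) *m (1%:M - adjmx B *m B) + adjmx B *m LX A X *m B.
  rewrite GG /LX LambdaX_conj.
  have -> : (1%:M : 'M_d) *t adjmx W = adjmx B by rewrite /B adjmx_tens adjmx1.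
  rewrite -/B !adjmxM adjmxK !mulmxDr !mulmxDl mulmx1 !mulmxA.
  by rewrite !addrA subrK.
exact: psdmx_adj.
Qed.

Lemma word_eval_cons n (X : mxtuple R g n) j u :
  word_eval X (j :: u) = X j *m word_eval X u.
Proof. by rewrite /word_eval big_cons mulmxE. Qed.

Lemma word_eval_nil n (X : mxtuple R g n) : word_eval X [::] = 1%:M.
Proof. by rewrite /word_eval big_nil. Qed.

Lemma unvec_poly_eval k l (Q : freepoly R g k l) n (X : mxtuple R g n)
    (v : 'cV[C]_(l * n)) :
  unvec (poly_eval Q X *m v) = \sum_(w <- finsupp Q) word_eval X w *m unvec v *m (Q w)^T.
Proof.
by rewrite /poly_eval mulmx_suml unvec_sum; apply: eq_bigr => w _; rewrite unvec_tens.
Qed.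

Lemma sqnorm_adj_iso n m (W : 'M[C]_(n, m)) p (Z : 'M[C]_(n, p)) :
  W *m adjmx W *m Z = Z -> sqnorm (adjmx W *m Z) = sqnorm Z.
Proof.
move=> h; apply: complexI; rewrite !sqnormE adjmxM adjmxK -mulmxA.
by rewrite [W *m _]mulmxA h.
Qed.

(** Computing [Q(X) v] only involves the vectors [w(X) v_i], with [v_i] a component of
    [v] and [w] a suffix of a word of [Q].  The number [N] of these vectors depends on
    [Q] alone, and compressing [X] to their span changes neither [v] nor [Q(X) v].
    Hence bounds for [Q] on all levels of a spectrahedron follow from level [N]. *)
Lemma compression k l (Q : freepoly R g k l) :
  exists N, forall d (A : mxtuple R g d) n (X : mxtuple R g n) (v : 'cV[C]_(l * n)),
    spectrahedron A X -> exists (Y : mxtuple R g N) (u : 'cV[C]_(l * N)),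
    [/\ spectrahedron A Y, sqnorm u = sqnorm v &
      sqnorm (poly_eval Q Y *m u) = sqnorm (poly_eval Q X *m v)].
Proof.
(* The suffixes of the words of [Q]; the empty word is added so that the span
   contains the components of [v] even when [Q] is zero. *)
pose ws := [::] :: flatten [seq [seq drop i w | i <- iota 0 (size w).+1] | w <- finsupp Q].
have ws_suff (w' w : seq 'I_g) : w' ++ w \in finsupp Q -> w \in ws.
  move=> h; rewrite inE; apply/orP; right; apply/flatten_mapP; exists (w' ++ w) => //.
  apply/mapP; exists (size w'); last by rewrite drop_size_cat.
  by rewrite mem_iota size_cat /=; lia.
exists (size ws * l)%N => d A n X v hX.
pose V := unvec v.
pose s := [seq col i (word_eval X w *m V) | w <- ws, i <- enum 'I_l].
have size_s : size s = (size ws * l)%N by rewrite size_allpairs size_enum_ord.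
have [W [WWW Ws]] := partial_isometry size_s.
have fixed w : w \in ws -> W *m adjmx W *m (word_eval X w *m V) = word_eval X w *m V.
  set Z := word_eval X w *m V => hw; apply/matrixP => a i.
  have /Ws : col i Z \in s.
    by apply: allpairs_f => //; rewrite mem_enum.
  by rewrite !colE mulmxA -!colE => /matrixP/(_ a 0); rewrite !mxE.
have fixedV : W *m adjmx W *m V = V.
  by have := fixed [::]; rewrite word_eval_nil mul1mx; apply; rewrite inE eqxx.
pose Y j := adjmx W *m X j *m W.
have YX w' w : w' ++ w \in finsupp Q ->
    word_eval Y w *m (adjmx W *m V) = adjmx W *m (word_eval X w *m V).
  elim: w w' => [|j w IH] w' hw; first by rewrite !word_eval_nil !mul1mx.
  rewrite !word_eval_cons -mulmxA (IH (rcons w' j)) ?cat_rcons //.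
  have /fixed hf : w \in ws by apply: (ws_suff (rcons w' j)); rewrite cat_rcons.
  by rewrite /Y -mulmxA -mulmxA [W *m _]mulmxA hf !mulmxA.
exists Y, (mkvec (adjmx W *m V)); split.
- exact: spectrahedron_compress.
- by rewrite -[LHS]sqnorm_unvec mkvecK sqnorm_adj_iso // sqnorm_unvec.
have E : unvec (poly_eval Q Y *m mkvec (adjmx W *m V)) =
    adjmx W *m unvec (poly_eval Q X *m v).
  rewrite !unvec_poly_eval mkvecK mulmx_sumr big_seq [RHS]big_seq.
  by apply: eq_bigr => w hw; rewrite (YX [::]) // !mulmxA.
rewrite -sqnorm_unvec E sqnorm_adj_iso ?sqnorm_unvec // unvec_poly_eval mulmx_sumr.
rewrite big_seq [RHS]big_seq; apply: eq_bigr => w hw.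
by rewrite mulmxA fixed //; apply: (ws_suff [::]).
Qed.

End Compression.

(** * Operator norms *)

Section Norms.
Variable R : realType.
Local Notation C := R[i].

(** The power of 2 comes from iterating the parallelogram bound. *)
Lemma sqnorm_sum_le m n (I : Type) (s : seq I) (F : I -> 'M[C]_(m, n)) :
  sqnorm (\sum_(i <- s) F i) <= 2 ^+ size s * \sum_(i <- s) sqnorm (F i).
Proof.
elim: s => [|i s IH]; first by rewrite !big_nil sqnorm0 mulr0.
rewrite !big_cons /= exprS; apply: (le_trans (sqnormD_le _ _)).
have h1 : 1 <= 2 ^+ size s :> R by rewrite exprn_ege1 // ler1n.
have := sqnorm_ge0 (F i); nra.
Qed.

(** A crude bound, enough to make operator norms finite and, applied to the fixed
    coefficient matrices, independent of the size of the evaluation point. *)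
Lemma sqnorm_mulmx_col m n (M : 'M[C]_(m, n)) (v : 'cV[C]_n) :
  sqnorm (M *m v) <= 2 ^+ n * sqnorm M * sqnorm v.
Proof.
have -> : M *m v = \sum_j v j 0 *: col j M.
  by apply/matrixP => i k; rewrite !mxE summxE; apply: eq_bigr => j _; rewrite !mxE mulrC ord1.
apply: (le_trans (sqnorm_sum_le _ _)); rewrite -mulrA.
have -> : size (index_enum 'I_n) = n by rewrite -[RHS]card_ord cardT enumT.
apply: ler_wpM2l; first by rewrite exprn_ge0.
rewrite (sqnorm_cols M) mulr_suml; apply: ler_sum => j _.
by rewrite sqnormZ mulrC ler_wpM2l ?sqnorm_ge0 // sqnorm_entry.
Qed.

Lemma sqnorm_mulmx_cols m n p (M : 'M[C]_(m, n)) (Z : 'M[C]_(n, p)) c :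
  (forall v : 'cV[C]_n, sqnorm (M *m v) <= c * sqnorm v) -> sqnorm (M *m Z) <= c * sqnorm Z.
Proof.
move=> h; rewrite !sqnorm_cols mulr_sumr; apply: ler_sum => j _.
by rewrite colE -mulmxA -colE.
Qed.

Let unit_values m n (M : 'M[C]_(m, n)) : set R :=
  [set vnorm (M *m v) | v in [set v : 'cV[C]_n | vnorm v <= 1]]%classic.

Lemma opnorm_has_sup m n (M : 'M[C]_(m, n)) : has_sup (unit_values M).
Proof.
split.
  by exists (vnorm (M *m 0)), 0 => //=; rewrite vnormE sqnorm0 sqrtr0.
exists (Num.sqrt (2 ^+ n * sqnorm M)) => _ [v /= v1 <-].
rewrite vnormE ler_sqrt; last by rewrite mulr_ge0 ?exprn_ge0 ?sqnorm_ge0.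
apply: (le_trans (sqnorm_mulmx_col _ _)); rewrite -[leRHS]mulr1.
apply: ler_wpM2l; first by rewrite mulr_ge0 ?exprn_ge0 ?sqnorm_ge0.
by rewrite -vnorm_sqr expr_le1 ?vnorm_ge0.
Qed.

Lemma opnorm_ub m n (M : 'M[C]_(m, n)) c : 0 <= c ->
  (forall v : 'cV[C]_n, sqnorm (M *m v) <= c ^+ 2 * sqnorm v) -> opnorm M <= c.
Proof.
move=> c0 h; apply: sup_le_ub; first by case: (opnorm_has_sup M).
move=> _ [v /= v1 <-].
rewrite -(ler_pXn2r (n := 2)) ?nnegrE ?vnorm_ge0 // vnorm_sqr.
apply: (le_trans (h v)); rewrite -[leRHS]mulr1 ler_wpM2l ?sqr_ge0 //.
by rewrite -vnorm_sqr expr_le1 ?vnorm_ge0.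
Qed.

Lemma opnorm_ge0 m n (M : 'M[C]_(m, n)) : 0 <= opnorm M.
Proof.
apply: (le_trans (vnorm_ge0 (M *m 0))); apply: sup_upper_bound.
  exact: opnorm_has_sup.
by exists 0 => //=; rewrite vnormE sqnorm0 sqrtr0.
Qed.

Lemma sqnorm_opnorm m n (M : 'M[C]_(m, n)) (v : 'cV[C]_n) :
  sqnorm (M *m v) <= opnorm M ^+ 2 * sqnorm v.
Proof.
have [h0|h0] := eqVneq (sqnorm v) 0.
  by rewrite h0 (sqnorm_eq0 h0) mulmx0 sqnorm0 mulr0.
have [u u1 [a ->]] := sqnorm_normalize h0.
rewrite -scalemxAr (sqnormZr a (M *m u)) (sqnormZr a u) u1 mulr1 mulrC.
rewrite ler_wpM2r ?sqr_ge0 // -vnorm_sqr ler_pXn2r ?nnegrE ?vnorm_ge0 ?opnorm_ge0 //.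
apply: sup_upper_bound; first exact: opnorm_has_sup.
by exists u => //=; rewrite vnormE u1 sqrtr1.
Qed.

Lemma opnorm_entry m n (M : 'M[C]_(m, n)) i j :
  Re (M i j) ^+ 2 + Im (M i j) ^+ 2 <= opnorm M ^+ 2.
Proof.
have := sqnorm_opnorm M (delta_mx j 0); rewrite -colE.
have -> : sqnorm (delta_mx j 0 : 'cV[C]_n) = 1.
  rewrite /sqnorm (bigD1 j) //= big_ord1 mxE !eqxx /= expr1n expr0n addr0 big1 ?addr0 //.
  by move=> k kj; rewrite big_ord1 mxE (negPf kj) /= expr0n addr0.
by rewrite mulr1; apply: le_trans; have := sqnorm_entry (col j M) i 0; rewrite mxE.
Qed.

Variable g : nat.

(** The constant is uniform over all sizes [n]: the coefficients act on the right of
    [unvec v] through matrices of fixed size, and the [X j] on its left. *)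
Lemma LambdaX_bound d (A : mxtuple R g d) N0 : exists2 K : R, 0 <= K &
  forall n (X : mxtuple R g n), (forall j, opnorm (X j) <= N0) ->
  forall v : 'cV[C]_(d * n), sqnorm (LambdaX A X *m v) <= K * sqnorm v.
Proof.
exists (2 ^+ size (index_enum 'I_g) * \sum_j (N0 ^+ 2 * (2 ^+ d * sqnorm (A j)))).
  apply: mulr_ge0; first by rewrite exprn_ge0.
  by apply: sumr_ge0 => j _; rewrite mulr_ge0 ?sqr_ge0 // mulr_ge0 ?exprn_ge0 ?sqnorm_ge0.
move=> n X hX v; rewrite -sqnorm_unvec /LambdaX mulmx_suml unvec_sum.
apply: (le_trans (sqnorm_sum_le _ _)); rewrite -mulrA.
apply: ler_wpM2l; first by rewrite exprn_ge0.
rewrite mulr_suml; apply: ler_sum => j _; rewrite unvec_tens -mulmxA -mulrA.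
apply: (le_trans (sqnorm_mulmx_cols _ (c := opnorm (X j) ^+ 2) _)).
  by move=> w; apply: sqnorm_opnorm.
apply: ler_pM; rewrite ?sqr_ge0 ?sqnorm_ge0 //.
  have h0 := opnorm_ge0 (X j).
  by rewrite ler_pXn2r ?nnegrE ?(le_trans h0 (hX j)).
rewrite -sqnorm_tr trmx_mul trmxK -(sqnorm_unvec v) -[leRHS](congr1 _ (sqnorm_tr _)).
by apply: sqnorm_mulmx_cols => w; apply: sqnorm_mulmx_col.
Qed.

Lemma tens1_bound k l (B : 'M[C]_(k, l)) n (v : 'cV[C]_(l * n)) :
  sqnorm ((B *t (1%:M : 'M[C]_n)) *m v) <= 2 ^+ l * sqnorm B * sqnorm v.
Proof.
rewrite -sqnorm_unvec unvec_tens mul1mx -sqnorm_tr trmx_mul trmxK -(sqnorm_unvec v).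
rewrite -[leRHS](congr1 _ (sqnorm_tr _)).
by apply: sqnorm_mulmx_cols => w; apply: sqnorm_mulmx_col.
Qed.

Lemma tupnorm_opnorm n (X : mxtuple R g n) N0 j : tupnorm X <= N0 -> opnorm (X j) <= N0.
Proof. by apply: le_trans; rewrite /tupnorm; apply: le_bigmax. Qed.

End Norms.

(** * Compactness of the levels *)

Section Continuity.
Variables (R : realType) (T : topologicalType).
Local Notation C := R[i].
Local Open Scope classical_set_scope.

(** Continuity is expressed on real and imaginary parts, so that only the topology of
    [R] is involved. *)
Definition ccontinuous (F : T -> C) : Prop :=
  continuous (fun x => Re (F x)) /\ continuous (fun x => Im (F x)).

Lemma ccontinuous_cst c : ccontinuous (fun=> c).
Proof. by split; apply: cst_continuous. Qed.

Lemma ccontinuousD F G : ccontinuous F -> ccontinuous G -> ccontinuous (fun x => F x + G x).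
Proof.
move=> [Fr Fi] [Gr Gi]; split.
  rewrite (_ : (fun x => _) = (fun x => Re (F x)) + (fun x => Re (G x))).
    by move=> x; apply: continuousD; [apply: Fr | apply: Gr].
  by apply/funext => x; rewrite raddfD.
rewrite (_ : (fun x => _) = (fun x => Im (F x)) + (fun x => Im (G x))).
  by move=> x; apply: continuousD; [apply: Fi | apply: Gi].
by apply/funext => x; rewrite raddfD.
Qed.

Lemma continuous_mulR (f h : T -> R) : continuous f -> continuous h ->
  continuous (fun x => f x * h x).
Proof. by move=> cf ch x; apply: continuousM; [apply: cf | apply: ch]. Qed.

Lemma continuous_addR (f h : T -> R) : continuous f -> continuous h ->
  continuous (fun x => f x + h x).
Proof. by move=> cf ch x; apply: continuousD; [apply: cf | apply: ch]. Qed.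

Lemma continuous_oppR (f : T -> R) : continuous f -> continuous (fun x => - f x).
Proof. by move=> cf x; apply: continuousN; apply: cf. Qed.

Lemma ccontinuousM F G : ccontinuous F -> ccontinuous G -> ccontinuous (fun x => F x * G x).
Proof.
move=> [Fr Fi] [Gr Gi]; split.
  rewrite (_ : (fun x => _) = (fun x => Re (F x) * Re (G x) + - (Im (F x) * Im (G x)))).
    apply: continuous_addR; first exact: continuous_mulR.
    by apply: continuous_oppR; exact: continuous_mulR.
  by apply/funext => x; case: (F x) (G x) => a b [].
rewrite (_ : (fun x => _) = (fun x => Re (F x) * Im (G x) + Im (F x) * Re (G x))).
  by apply: continuous_addR; exact: continuous_mulR.
by apply/funext => x; case: (F x) (G x) => a b [].
Qed.

Lemma ccontinuous_conj F : ccontinuous F -> ccontinuous (fun x => conjc (F x)).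
Proof.
move=> [Fr Fi]; split.
  by rewrite (_ : (fun x => _) = (fun x => Re (F x))) //; apply/funext => x; case: (F x).
rewrite (_ : (fun x => _) = (fun x => - Im (F x))); first exact: continuous_oppR.
by apply/funext => x; case: (F x).
Qed.

Lemma ccontinuous_sum (I : Type) (s : seq I) (F : I -> T -> C) :
  (forall i, ccontinuous (F i)) -> ccontinuous (fun x => \sum_(i <- s) F i x).
Proof.
move=> h; elim: s => [|i s IH].
  rewrite (_ : (fun x => _) = fun=> 0); first exact: ccontinuous_cst.
  by apply/funext => x; rewrite big_nil.
rewrite (_ : (fun x => _) = fun x => F i x + \sum_(j <- s) F j x); first exact: ccontinuousD.
by apply/funext => x; rewrite big_cons.
Qed.

Definition mxcontinuous m n (F : T -> 'M[C]_(m, n)) : Prop :=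
  forall i j, ccontinuous (fun x => F x i j).

Lemma mxcontinuous_cst m n (M : 'M[C]_(m, n)) : mxcontinuous (fun=> M).
Proof. by move=> i j; apply: ccontinuous_cst. Qed.

Lemma mxcontinuousD m n (F G : T -> 'M[C]_(m, n)) :
  mxcontinuous F -> mxcontinuous G -> mxcontinuous (fun x => F x + G x).
Proof.
move=> hF hG i j; rewrite (_ : (fun x => _) = fun x => F x i j + G x i j).
  exact: ccontinuousD.
by apply/funext => x; rewrite mxE.
Qed.

Lemma mxcontinuousM m n p (F : T -> 'M[C]_(m, n)) (G : T -> 'M[C]_(n, p)) :
  mxcontinuous F -> mxcontinuous G -> mxcontinuous (fun x => F x *m G x).
Proof.
move=> hF hG i j; rewrite (_ : (fun x => _) = fun x => \sum_k F x i k * G x k j).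
  by apply: ccontinuous_sum => k; apply: ccontinuousM.
by apply/funext => x; rewrite mxE.
Qed.

Lemma mxcontinuous_adj m n (F : T -> 'M[C]_(m, n)) :
  mxcontinuous F -> mxcontinuous (fun x => adjmx (F x)).
Proof.
move=> hF i j; rewrite (_ : (fun x => _) = fun x => conjc (F x j i)); first exact: ccontinuous_conj.
by apply/funext => x; rewrite adjmxE.
Qed.

Lemma mxcontinuous_tens m n p q (F : T -> 'M[C]_(m, n)) (G : T -> 'M[C]_(p, q)) :
  mxcontinuous F -> mxcontinuous G -> mxcontinuous (fun x => F x *t G x).
Proof.
move=> hF hG i j; case: (mxtens_indexP i) => i1 i2; case: (mxtens_indexP j) => j1 j2.
rewrite (_ : (fun x => _) = fun x => F x i1 j1 * G x i2 j2); first exact: ccontinuousM.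
by apply/funext => x; rewrite tensmxE.
Qed.

Lemma mxcontinuous_sum m n (I : Type) (s : seq I) (F : I -> T -> 'M[C]_(m, n)) :
  (forall i, mxcontinuous (F i)) -> mxcontinuous (fun x => \sum_(i <- s) F i x).
Proof.
move=> h i j; rewrite (_ : (fun x => _) = fun x => \sum_(k <- s) F k x i j).
  by apply: ccontinuous_sum => k; apply: h.
by apply/funext => x; rewrite summxE.
Qed.

Lemma continuous_sqnorm m n (F : T -> 'M[C]_(m, n)) :
  mxcontinuous F -> continuous (fun x => sqnorm (F x)).
Proof.
move=> hF.
have : ccontinuous (fun x => \sum_i (adjmx (F x) *m F x) i i).
  by apply: ccontinuous_sum => i; apply: (mxcontinuousM (mxcontinuous_adj hF) hF).
case=> + _; rewrite (_ : (fun x => Re _) = (fun x => sqnorm (F x))) //.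
by apply/funext => x; rewrite -[RHS]/(Re (sqnorm (F x))%:C) sqnormE.
Qed.

Lemma closed_ge0c (F : T -> C) : ccontinuous F -> closed [set x | 0 <= F x].
Proof.
move=> [Fr Fi].
rewrite (_ : [set x | _] = (fun x => Im (F x)) @^-1` [set y | y = 0] `&`
    (fun x => Re (F x)) @^-1` [set y | 0 <= y]).
  apply: closedI.
    by move/continuous_closedP: Fi; apply; exact: closed_eq.
  by move/continuous_closedP: Fr; apply; exact: closed_ge.
apply/seteqP; split=> x /=; rewrite lecE /=.
  by case/andP=> /eqP.
by case=> -> ->; rewrite eqxx.
Qed.

End Continuity.

Section Compactness.
Variables (R : realType) (g d : nat) (A : mxtuple R g d).
Hypothesis hA : free_bounded (spectrahedron A).
Local Notation C := R[i].
Local Open Scope classical_set_scope.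

Section Level.
Variables (N M : nat).

(** Real coordinates of a pair (X, v): the entries of the matrices and of the vector,
    each with a flag selecting the real or the imaginary part.  With the product
    topology, Tychonoff's theorem gives compactness of boxes. *)
Definition coord : Type := ((('I_g * ('I_N * 'I_N)) + 'I_M) * bool)%type.

Definition point : topologicalType := prod_topology (fun _ : coord => R : topologicalType).

Definition ptX (f : point) : mxtuple R g N :=
  fun j => \matrix_(a, b) (f (inl (j, (a, b)), true) +i* f (inl (j, (a, b)), false)).

Definition ptv (f : point) : 'cV[C]_M := \col_a (f (inr a, true) +i* f (inr a, false)).

Definition mkpt (X : mxtuple R g N) (v : 'cV[C]_M) : point := fun c =>
  let z := match c.1 with inl (j, (a, b)) => X j a b | inr a => v a 0 end in
  if c.2 then Re z else Im z.

Lemma mkptX X v j : ptX (mkpt X v) j = X j.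
Proof. by apply/matrixP => a b; rewrite mxE /mkpt /=; case: (X j a b). Qed.

Lemma mkptv X v : ptv (mkpt X v) = v.
Proof. by apply/matrixP => a b; rewrite mxE /mkpt /= ord1; case: (v a 0). Qed.

Lemma point_continuous (c : coord) : continuous (fun f : point => f c).
Proof. exact: (@proj_continuous _ (fun _ : coord => R : topologicalType) c). Qed.

Lemma mxcontinuous_ptX j : mxcontinuous (fun f => ptX f j).
Proof.
move=> a b; split.
  by rewrite (_ : (fun x => _) = (fun f : point => f (inl (j, (a, b)), true)));
    [exact: point_continuous | apply/funext => x; rewrite mxE].
by rewrite (_ : (fun x => _) = (fun f : point => f (inl (j, (a, b)), false)));
  [exact: point_continuous | apply/funext => x; rewrite mxE].
Qed.

Lemma mxcontinuous_ptv : mxcontinuous ptv.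
Proof.
move=> a b; split.
  by rewrite (_ : (fun x => _) = (fun f : point => f (inr a, true)));
    [exact: point_continuous | apply/funext => x; rewrite mxE].
by rewrite (_ : (fun x => _) = (fun f : point => f (inr a, false)));
  [exact: point_continuous | apply/funext => x; rewrite mxE].
Qed.

Definition levelset : set point := [set f | spectrahedron A (ptX f) /\ sqnorm (ptv f) = 1].

(** Closed, as positivity of each value of the quadratic form is a closed condition,
    and contained in a box, because [free_bounded] bounds the entries. *)
Lemma compact_levelset : compact levelset.
Proof.
case: hA => N0 hN0.
pose B := Num.max 1 N0.
have B0 : 0 <= B by rewrite le_max ler01.
have B1 : 1 <= B ^+ 2 by rewrite exprn_ege1 // le_max lexx.
apply: (@subclosed_compact _ _ [set f : point | forall c, `[- B, B] (f c)]).
- rewrite (_ : levelset =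
      (\bigcap_(v in [set: 'cV[C]_(d * N)])
        [set f : point | 0 <= (adjmx v *m LX A (ptX f) *m v) 0 0]) `&`
      (fun f => sqnorm (ptv f)) @^-1` [set y | y = 1]).
    apply: closedI.
      apply: closed_bigI => v _; apply: closed_ge0c.
      suff h : mxcontinuous (fun f : point => adjmx v *m LX A (ptX f) *m v) by apply: h.
      apply: mxcontinuousM; last exact: mxcontinuous_cst.
      apply: mxcontinuousM; first exact: mxcontinuous_cst.
      have h : mxcontinuous (fun f => LambdaX A (ptX f)).
        apply: mxcontinuous_sum => j; apply: mxcontinuous_tens; first exact: mxcontinuous_cst.
        exact: mxcontinuous_ptX.
      apply: mxcontinuousD; last exact: mxcontinuous_adj.
      by apply: mxcontinuousD => //; apply: mxcontinuous_cst.
    have /continuous_closedP := continuous_sqnorm mxcontinuous_ptv.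
    by apply; exact: closed_eq.
  apply/seteqP; split=> f /=.
    by move=> [h1 h2]; split=> // v _; apply: h1.
  by move=> [h1 h2]; split=> // v; apply: h1.
- apply: (@tychonoff coord (fun=> R : topologicalType) (fun=> `[- B, B])) => c.
  exact: segment_compact.
move=> f [hX hv] c.
suff : f c ^+ 2 <= B ^+ 2.
  move=> h; rewrite /= in_itv /= -ler_norml -(ler_pXn2r (n := 2)) ?nnegrE //.
  by rewrite real_normK ?num_real.
case: c => -[[j [a b]]|a] s.
  have := opnorm_entry (ptX f j) a b; rewrite mxE /=.
  have h0 := opnorm_ge0 (ptX f j).
  have h1 := tupnorm_opnorm j (hN0 _ _ hX).
  have h2 : opnorm (ptX f j) ^+ 2 <= B ^+ 2.
    by rewrite ler_pXn2r ?nnegrE // le_max h1 orbT.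
  have := sqr_ge0 (f (inl (j, (a, b)), true)); have := sqr_ge0 (f (inl (j, (a, b)), false)).
  by case: s; lra.
have := sqnorm_entry (ptv f) a 0; rewrite hv mxE /=.
have := sqr_ge0 (f (inr a, true)); have := sqr_ge0 (f (inr a, false)).
by case: s; lra.
Qed.

End Level.

Variables (k l : nat) (Q : freepoly R g k l).

Lemma mxcontinuous_poly N :
  mxcontinuous (fun f : point N (l * N) => poly_eval Q (ptX f) *m ptv f).
Proof.
apply: mxcontinuousM; last exact: mxcontinuous_ptv.
apply: mxcontinuous_sum => w; apply: mxcontinuous_tens; first exact: mxcontinuous_cst.
elim: w => [|j w IH].
  rewrite (_ : (fun x => _) = fun=> 1%:M); first exact: mxcontinuous_cst.
  by apply/funext => x; rewrite word_eval_nil.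
rewrite (_ : (fun x => _) = fun x => ptX x j *m word_eval (ptX x) w).
  by apply: mxcontinuousM => //; apply: mxcontinuous_ptX.
by apply/funext => x; rewrite word_eval_cons.
Qed.

Definition attained (x : R) : Prop :=
  exists n (X : mxtuple R g n) (v : 'cV[C]_(l * n)),
    [/\ spectrahedron A X, sqnorm v = 1 & sqnorm (poly_eval Q X *m v) = x].

(** By [compression] every value already occurs at one fixed level, where it is the
    value of a continuous function on a compact set. *)
Lemma attained_extrema : (forall x, ~ attained x) \/
  exists lo hi, [/\ attained lo, attained hi & forall x, attained x -> lo <= x <= hi].
Proof.
have [N hN] := compression Q.
pose K := @levelset N (l * N).
pose f (p : point N (l * N)) := sqnorm (poly_eval Q (ptX p) *m ptv p).
have lift x : attained x -> exists2 p, K p & f p = x.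
  move=> [n [X [v [hX hv <-]]]].
  have [Y [u [hY hu <-]]] := hN _ A n X v hX.
  have E : ptX (mkpt Y u) = Y by apply/funext => j; rewrite mkptX.
  exists (mkpt Y u); first by split; rewrite ?E ?mkptv ?hu.
  by rewrite /f E mkptv.
have down p : K p -> attained (f p) by move=> [h1 h2]; exists N, (ptX p), (ptv p).
have [[p0 Kp0]|K0] := pselect (K !=set0); last first.
  by left=> x /lift[p Kp _]; apply: K0; exists p.
right.
have cf : {within K, continuous f}.
  by apply: continuous_subspaceT; apply: continuous_sqnorm; apply: mxcontinuous_poly.
have K0 : K !=set0 by exists p0.
have [pl] := compact_EVT_min K0 (@compact_levelset _ _) cf.
have [ph] := compact_EVT_max K0 (@compact_levelset _ _) cf.
rewrite !inE => Kh hh Kl hl; exists (f pl), (f ph); split; try exact: down.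
by move=> x /lift[p Kp <-]; rewrite hl ?hh // inE.
Qed.

Lemma poly_lt_uniform c :
  (forall n (X : mxtuple R g n) (v : 'cV[C]_(l * n)),
     spectrahedron A X -> sqnorm v = 1 -> sqnorm (poly_eval Q X *m v) < c) ->
  exists2 c', c' < c & forall n (X : mxtuple R g n) (v : 'cV[C]_(l * n)),
     spectrahedron A X -> sqnorm (poly_eval Q X *m v) <= c' * sqnorm v.
Proof.
move=> h; have [c' c'c hc'] : exists2 c', c' < c & forall x, attained x -> x <= c'.
  case: attained_extrema => [no|[lo [hi [_ [n [X [v [h1 h2 h3]]]] hlh]]]].
    by exists (c - 1); [rewrite ltrBlDr ltrDl | move=> x /no].
  by exists hi; [rewrite -h3; apply: h | move=> x /hlh /andP[]].
exists c' => // n X v hX; have [h0|h0] := eqVneq (sqnorm v) 0.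
  by rewrite h0 (sqnorm_eq0 h0) mulmx0 sqnorm0 mulr0.
have [u u1 [a ->]] := sqnorm_normalize h0.
rewrite -scalemxAr !sqnormZr u1 mulr1 mulrC ler_wpM2r ?sqr_ge0 //.
by apply: hc'; exists n, X, u.
Qed.

Lemma poly_gt_uniform c :
  (forall n (X : mxtuple R g n) (v : 'cV[C]_(l * n)),
     spectrahedron A X -> sqnorm v = 1 -> c < sqnorm (poly_eval Q X *m v)) ->
  exists2 c', c < c' & forall n (X : mxtuple R g n) (v : 'cV[C]_(l * n)),
     spectrahedron A X -> c' * sqnorm v <= sqnorm (poly_eval Q X *m v).
Proof.
move=> h; have [c' c'c hc'] : exists2 c', c < c' & forall x, attained x -> c' <= x.
  case: attained_extrema => [no|[lo [hi [[n [X [v [h1 h2 h3]]]] _ hlh]]]].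
    by exists (c + 1); [rewrite ltrDl | move=> x /no].
  by exists lo; [rewrite -h3; apply: h | move=> x /hlh /andP[]].
exists c' => // n X v hX; have [h0|h0] := eqVneq (sqnorm v) 0.
  by rewrite h0 (sqnorm_eq0 h0) mulmx0 sqnorm0 mulr0.
have [u u1 [a ->]] := sqnorm_normalize h0.
rewrite -scalemxAr !sqnormZr u1 mulr1 mulrC ler_wpM2l ?sqr_ge0 //.
by apply: hc'; exists n, X, u.
Qed.

End Compactness.

(** * Affine polynomials *)

Section Affine.
Variables (R : realType) (g : nat).
Local Notation C := R[i].

(** Any duplicate-free list of words containing the support may replace it, which
    spares computing the exact support of a given polynomial. *)
Lemma poly_eval_seq k l (Q : freepoly R g k l) (s : seq (seq 'I_g)) n (X : mxtuple R g n) :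
  uniq s -> (forall w, w \notin s -> Q w = 0) ->
  poly_eval Q X = \sum_(w <- s) Q w *t word_eval X w.
Proof.
move=> us hs; rewrite /poly_eval [RHS](bigID (fun w => w \in finsupp Q)) /=.
rewrite [X in _ + X]big1 ?addr0 => [|w]; last first.
  by rewrite memNfinsupp => /eqP ->; rewrite tens0mx.
rewrite -[RHS]big_filter; apply: perm_big; apply: uniq_perm; first exact: fset_uniq.
  exact: filter_uniq.
move=> w; rewrite mem_filter; case: (boolP (w \in finsupp Q)) => //= wQ.
by apply/esym; apply: contraTT wQ => /hs; rewrite memNfinsupp => ->.
Qed.

Definition affine_words : seq (seq 'I_g) := [::] :: [seq [:: j] | j <- enum 'I_g].

Definition affine_poly k l (M0 : 'M[C]_(k, l)) (M : 'I_g -> 'M[C]_(k, l)) : freepoly R g k l :=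
  [fsfun w in [fset w in affine_words]%fset =>
    if w is j :: _ then M j else M0].

Lemma affine_poly_eval k l (M0 : 'M[C]_(k, l)) (M : 'I_g -> 'M[C]_(k, l)) n
    (X : mxtuple R g n) :
  poly_eval (affine_poly M0 M) X = M0 *t 1%:M + \sum_j M j *t X j.
Proof.
rewrite (@poly_eval_seq _ _ _ affine_words).
- rewrite big_cons big_map big_enum /=; congr (_ + _).
    by rewrite fsfunE !inE /= word_eval_nil.
  apply: eq_bigr => j _; rewrite fsfunE ifT.
    by rewrite word_eval_cons word_eval_nil mulmx1.
  by rewrite !inE /= map_f // mem_enum.
- rewrite /= map_inj_uniq ?enum_uniq ?andbT; last by move=> i j [].
  by apply/mapP => -[].
by move=> w hw; rewrite fsfunE ifF // -[RHS](negbTE hw) !inE.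
Qed.

End Affine.

(** * Polynomials and pencils near a spectrahedron *)

Section Dilation.
Variables (R : realType) (g d : nat) (A : mxtuple R g d).
Hypothesis hA : free_bounded (spectrahedron A).
Local Notation C := R[i].

Lemma scale_tens (a : C) m n p q (B : 'M[C]_(m, n)) (D : 'M[C]_(p, q)) :
  B *t (a *: D) = a *: (B *t D).
Proof. by apply/matrixP => i j; rewrite !mxE mulrCA. Qed.

Lemma scale_tensl (a : C) m n p q (B : 'M[C]_(m, n)) (D : 'M[C]_(p, q)) :
  (a *: B) *t D = a *: (B *t D).
Proof. by apply/matrixP => i j; rewrite !mxE mulrA. Qed.

Lemma LambdaX_scale e (E : mxtuple R g e) (a : C) n (X : mxtuple R g n) :
  LambdaX E (fun j => a *: X j) = a *: LambdaX E X.
Proof. by rewrite /LambdaX scaler_sumr; apply: eq_bigr => j _; rewrite scale_tens. Qed.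

Lemma sqnorm_sub_scale n (L : 'M[C]_n) (v : 'cV[C]_n) (rho : R) :
  sqnorm (L *m v - rho%:C *: v) =
    sqnorm (L *m v) - 2 * rho * Re ((adjmx v *m L *m v) 0 0) + rho ^+ 2 * sqnorm v.
Proof.
have zE : (adjmx (L *m v) *m v) 0 0 = conjc ((adjmx v *m L *m v) 0 0).
  by rewrite -adjmxE !adjmxM adjmxK mulmxA.
apply: complexI; rewrite -sqnorm_colE adjmxB mulmxBl !mulmxBr adjmxZ conjc_real.
rewrite -!scalemxAl -!scalemxAr scalerA.
rewrite [adjmx v *m (L *m v)]mulmxA; move: zE (sqnorm_colE (L *m v)) (sqnorm_colE v).
move: (adjmx (L *m v) *m (L *m v)) (adjmx (L *m v) *m v) (adjmx v *m L *m v) (adjmx v *m v).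
move=> a b z w hb ha hw; rewrite !mxE ha hb hw.
by case: (z 0 0) => x y; simpc; apply/eqP; rewrite eq_complex /=; apply/andP; split;
  apply/eqP; ring.
Qed.

Lemma LambdaX_uniform e (E : mxtuple R g e) : exists2 K : R, 0 <= K &
  forall n (X : mxtuple R g n), spectrahedron A X ->
  forall v : 'cV[C]_(e * n), sqnorm (LambdaX E X *m v) <= K * sqnorm v.
Proof.
case: hA => N hN; have [K K0 hK] := LambdaX_bound E N; exists K => // n X hX.
by apply: hK => j; apply: tupnorm_opnorm; apply: hN.
Qed.

(** At each point [|Q| < 1] means that all the values of [|Q(X) v|^2] are below 1; these
    values have a maximum over all sizes, which gives the margin. *)
Lemma pseudoconvex_margin k l (Q : freepoly R g k l) :
  free_subset (spectrahedron A) (pseudoconvex Q) ->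
  exists s : R, 1 < s /\ free_subset (spectrahedron A) (Kset s Q).
Proof.
move=> hQ; have [|c c1 hc] := poly_lt_uniform hA (Q := Q) (c := 1).
  move=> n X v hX v1; have := sqnorm_opnorm (poly_eval Q X) v; rewrite v1 mulr1.
  by move=> h; apply: (le_lt_trans h); rewrite expr_lt1 ?opnorm_ge0 //; apply: hQ.
(* The maximum with a positive constant covers the case [c <= 0], in which the
   square root below would have no inverse. *)
pose b := Num.max c (1 / 4).
have b0 : 0 < b by rewrite lt_max; apply/orP; right; lra.
have b1 : b < 1 by rewrite gt_max c1 /=; lra.
exists (Num.sqrt b)^-1; split.
  by rewrite invf_gt1 ?sqrtr_gt0 // -[ltRHS]sqrtr1 ltr_sqrt.
move=> n X hX; rewrite /Kset /= mulrC ler_pdivrMr ?sqrtr_gt0 // mul1r.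
apply: opnorm_ub => [|v]; first exact: sqrtr_ge0.
rewrite sqr_sqrtr ?(ltW b0) //; apply: (le_trans (hc n X v hX)).
by rewrite ler_wpM2r ?sqnorm_ge0 // le_max lexx.
Qed.

(** On a bounded set a large disc is close to a half-plane.  Expanding
    [|(L - rho) v|^2 = |L v|^2 - 2 rho Re <L v, v> + rho^2 |v|^2] for [L = Lambda_A(X)],
    the condition [|(L - rho) v| <= r |v|] with [r^2 = rho^2 + t rho] forces
    [2 Re <L v, v> >= - t |v|^2], that is, [X] in [t D_A]; conversely, on [D_A] one has
    [|L v|^2 <= K |v|^2], so that it holds strictly once [K < (t - 1) rho].  So the
    pseudoconvex set of [(Lambda_A - rho) / r] lies between [D_A] and [t D_A]. *)
Lemma pseudoconvex_between (t : R) : 1 < t ->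
  exists (k l : nat) (Q : freepoly R g k l),
    free_subset (spectrahedron A) (pseudoconvex Q) /\
    free_subset (pseudoconvex Q) (free_scale t (spectrahedron A)).
Proof.
move=> t1; have [K K0 hK] := LambdaX_uniform A.
pose rho := (K + 1) / (t - 1).
have rho0 : 0 < rho by rewrite divr_gt0 //; lra.
have rhoK : K < (t - 1) * rho by rewrite mulrC divfK; lra.
pose r := Num.sqrt (rho ^+ 2 + t * rho).
have rr : r ^+ 2 = rho ^+ 2 + t * rho by rewrite sqr_sqrtr //; nra.
have r0 : r != 0 by rewrite sqrtr_eq0 -ltNge; nra.
pose Q := affine_poly ((- rho / r)%:C *: 1%:M) (fun j => (r^-1)%:C *: A j).
have QE n (X : mxtuple R g n) (v : 'cV[C]_(d * n)) :
    poly_eval Q X *m v = (r^-1)%:C *: (LambdaX A X *m v - rho%:C *: v).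
  rewrite affine_poly_eval mulmxDl scalerBr addrC; congr (_ + _).
    rewrite /LambdaX scalemxAl scaler_sumr; congr (_ *m _).
    by apply: eq_bigr => j _; rewrite scale_tensl.
  by rewrite scale_tensl tens11 -scalemxAl mul1mx scalerA -scaleNr -rmorphM -rmorphN /= mulNr mulrC.
have QhE n (X : mxtuple R g n) (v : 'cV[C]_(d * n)) :
    r ^+ 2 * sqnorm (poly_eval Q X *m v) = sqnorm (LambdaX A X *m v)
      - 2 * rho * Re ((adjmx v *m LambdaX A X *m v) 0 0) + rho ^+ 2 * sqnorm v.
  by rewrite QE sqnormZr mulrA exprVn mulfV ?sqrf_eq0 // mul1r sqnorm_sub_scale.
exists d, d, Q; split=> n X hX.
- pose th := (K + rho + rho ^+ 2) / r ^+ 2.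
  have r20 : 0 < r ^+ 2 by rewrite exprn_even_gt0.
  have th0 : 0 <= th by rewrite divr_ge0 //; nra.
  apply: (@le_lt_trans _ _ (Num.sqrt th)).
    apply: opnorm_ub => [|v]; first exact: sqrtr_ge0.
    rewrite sqr_sqrtr // /th mulrAC ler_pdivlMr // mulrC QhE.
    have := hX v; rewrite LX_form ler0c => h1; have h2 := hK _ _ hX v.
    by nra.
  rewrite -[ltRHS]sqrtr1 ltr_sqrt // ltr_pdivrMr // rr; lra.
exists (fun j => (t^-1)%:C *: X j); last first.
  by apply/funext => j; rewrite scalerA -rmorphM /= divff ?scale1r //; lra.
move=> v; rewrite LX_form ler0c LambdaX_scale -scalemxAr -scalemxAl mxE.
have -> : Re ((t^-1)%:C * (adjmx v *m LambdaX A X *m v) 0 0) =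
    t^-1 * Re ((adjmx v *m LambdaX A X *m v) 0 0).
  by case: ((adjmx v *m LambdaX A X *m v) 0 0) => x y /=; ring.
have h1 : sqnorm (poly_eval Q X *m v) <= sqnorm v.
  apply: (le_trans (sqnorm_opnorm _ _)); rewrite -[leRHS]mul1r ler_wpM2r ?sqnorm_ge0 //.
  by rewrite expr_le1 ?opnorm_ge0 //; apply: ltW.
have h2 : r ^+ 2 * sqnorm (poly_eval Q X *m v) <= r ^+ 2 * sqnorm v by rewrite ler_wpM2l ?sqr_ge0.
move: h2; rewrite QhE rr; set z := Re _ => h2; have h3 := sqnorm_ge0 (LambdaX A X *m v).
have h4 : 0 <= t * sqnorm v + 2 * z.
  rewrite -(pmulr_rge0 _ rho0); nra.
have -> : sqnorm v + 2 * (t^-1 * z) = t^-1 * (t * sqnorm v + 2 * z) by field; lra.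
by apply: mulr_ge0 => //; rewrite invr_ge0; lra.
Qed.

(** A pencil invertible on all of [D_A] is bounded below there, uniformly over all
    sizes, as its values [|(I - Lambda_E(X)) v|^2], [|v| = 1], have a positive minimum.
    Replacing [X] by [(1 + s) X] moves [(I - Lambda_E(X)) v] by [s |Lambda_E(X) v|],
    a quantity controlled on a bounded spectrahedron. *)
Lemma pencil_uniform (q : ratexpr R g) :
  (forall n (X : mxtuple R g n), spectrahedron A X -> \det (rpencil q X) != 0) ->
  exists t e : R, [/\ 1 < t, 0 < e &
    forall n (X : mxtuple R g n), free_scale t (spectrahedron A) X ->
    forall v : 'cV[C]_(rdim q * n), e * sqnorm v <= sqnorm (rpencil q X *m v)].
Proof.
move=> hq; pose P := affine_poly (1%:M : 'M_(rdim q)) (fun j => - @rE _ _ q j).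
have PE n (X : mxtuple R g n) : poly_eval P X = rpencil q X.
  rewrite affine_poly_eval tens11 /rpencil /LambdaX -sumrN; congr (_ + _).
  by apply: eq_bigr => j _; rewrite -scaleN1r scale_tensl scaleN1r.
have [|e e0 he] := poly_gt_uniform hA (Q := P) (c := 0).
  move=> n X v hX v1; rewrite lt0r sqnorm_ge0 andbT; apply/eqP => /sqnorm_eq0.
  rewrite PE => h; have := hq _ _ hX; rewrite -unitfE -/(_ \in unitmx) => hu.
  by move: v1; rewrite -[v](mulKmx hu) h mulmx0 sqnorm0 => /esym/eqP; rewrite oner_eq0.
have [K K0 hK] := LambdaX_uniform (@rE _ _ q).
(* [2 s^2 K <= 2 s K <= e / 2], so half of the lower bound survives the perturbation,
   and half is lost again to the factor 2 of the parallelogram bound. *)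
pose s := Num.min 1 (e / (4 * (K + 1))).
have s0 : 0 < s by rewrite lt_min ltr01 divr_gt0 //; lra.
have s1 : s <= 1 by rewrite ge_min lexx.
have sK : s * (4 * (K + 1)) <= e.
  by rewrite -ler_pdivlMr; [rewrite ge_min lexx orbT | lra].
exists (1 + s), (e / 4); split; [lra | lra |].
move=> n _ [X hX <-] v.
have E : rpencil q X *m v = rpencil q (fun j => (1 + s)%:C *: X j) *m v +
    s%:C *: (LambdaX (@rE _ _ q) X *m v).
  rewrite /rpencil LambdaX_scale !mulmxBl -scalemxAl rmorphD rmorph1 scalerDl scale1r.
  by rewrite opprD addrA subrK.
have := he _ X v hX; rewrite PE E => h1.
have := le_trans h1 (sqnormD_le _ _); rewrite sqnormZr => h2.
have h3 := hK _ _ hX v; have h4 := sqnorm_ge0 v.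
have h5 : s ^+ 2 * sqnorm (LambdaX (@rE _ _ q) X *m v) <= s * (K * sqnorm v).
  rewrite expr2 -mulrA; apply: ler_wpM2l; first exact: ltW.
  by apply: le_trans h3; rewrite ler_piMl ?sqnorm_ge0.
have h6 : s * (K * sqnorm v) <= e / 4 * sqnorm v.
  by rewrite mulrA ler_wpM2r //; nra.
lra.
Qed.

Lemma pencil_unit (q : ratexpr R g) n (X : mxtuple R g n) e : 0 < e ->
  (forall v : 'cV[C]_(rdim q * n), e * sqnorm v <= sqnorm (rpencil q X *m v)) ->
  rpencil q X \in unitmx.
Proof.
move=> e0 h; rewrite -unitmx_tr -row_free_unit -kermx_eq0; apply/eqP/row_matrixP => i.
rewrite row0; set u := row i _.
have hu : rpencil q X *m u^T = 0.
  by apply: trmx_inj; rewrite trmx_mul trmxK trmx0 /u -row_mul mulmx_ker row0.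
have := h u^T; rewrite hu sqnorm0 sqnorm_tr pmulr_rle0 // => hle.
by apply: sqnorm_eq0; apply/eqP; rewrite eq_le hle sqnorm_ge0.
Qed.

Lemma reval_bound (q : ratexpr R g) e : 0 < e ->
  exists B : R, forall n (X : mxtuple R g n),
  (forall v : 'cV[C]_(rdim q * n), e * sqnorm v <= sqnorm (rpencil q X *m v)) ->
  opnorm (reval q X) <= B.
Proof.
move=> e0.
pose c1 := 2 ^+ rdim q * sqnorm (adjmx (rc q)); pose c2 := 2 ^+ 1 * sqnorm (rb q).
have c10 : 0 <= c1 by rewrite mulr_ge0 ?exprn_ge0 ?sqnorm_ge0.
have c20 : 0 <= c2 by rewrite mulr_ge0 ?exprn_ge0 ?sqnorm_ge0.
have B0 : 0 <= c1 * (c2 / e) by rewrite mulr_ge0 // divr_ge0 // ltW.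
exists (Num.sqrt (c1 * (c2 / e))) => n X h.
apply: opnorm_ub => [|v]; first exact: sqrtr_ge0.
rewrite sqr_sqrtr // /reval -!mulmxA.
apply: (le_trans (tens1_bound _ _)); rewrite -[leRHS]mulrA.
apply: ler_wpM2l => //.
have hu := pencil_unit e0 h.
have := h (invmx (rpencil q X) *m ((rb q *t 1%:M) *m v)); rewrite mulKVmx // => h1.
rewrite mulrAC ler_pdivlMr // mulrC; apply: (le_trans h1).
exact: tens1_bound.
Qed.

End Dilation.

(** * Spans and resolvents over a field *)

(** The span of an arbitrary family, obtained as a subspace of least rank containing
    it: intersecting with a kernel that contains the family cannot lower the rank, so
    every linear condition satisfied by the family holds on [U]; hence also the
    stability of [U] under the maps that preserve the family. *)
Lemma span_family (F : fieldType) n (T : Type) (f : T -> 'rV[F]_n) :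
  exists U : 'M[F]_n, [/\ forall t, (f t <= U)%MS,
    forall k (M : 'M[F]_(n, k)), (forall t, f t *m M = 0) -> U *m M = 0 &
    forall S : 'M[F]_n, (forall t, exists t', f t *m S = f t') -> (U *m S <= U)%MS].
Proof.
have ex : exists r, `[< exists U : 'M[F]_n, (forall t, (f t <= U)%MS) /\ \rank U = r >].
  by exists n; apply/asboolP; exists 1%:M; split=> [t|]; rewrite ?submx1 ?mxrank1.
case: (ex_minnP ex) => r /asboolP[U [fU rU]] min.
have ann k (M : 'M[F]_(n, k)) : (forall t, f t *m M = 0) -> U *m M = 0.
  move=> fM; have fV t : (f t <= U :&: kermx M)%MS.
    by rewrite sub_capmx fU; apply/sub_kermxP.
  have := min (\rank (U :&: kermx M)%MS); rewrite -rU => /(_ _) h.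
  have {}h : (\rank U <= \rank (U :&: kermx M)%MS)%N.
    by apply: h; apply/asboolP; exists (U :&: kermx M)%MS.
  apply/sub_kermxP; apply: submx_trans (capmxSr U _).
  have [_ <-] := mxrank_leqif_sup (capmxSl U (kermx M)).
  by rewrite eqn_leq h mxrankS ?capmxSl.
exists U; split=> // S fS; rewrite submxE -mulmxA; apply/eqP; apply: ann => t.
have [t' ft'] := fS t; rewrite mulmxA ft'.
by apply/eqP; rewrite -submxE.
Qed.

(** The span [U] of the rows of all [B S^k] is annihilated by [D] and stable under
    [1 - S]; as [1 - S] is injective and [U] finite-dimensional, [U] is stable under
    the inverse of [1 - S] as well.  No smallness of [S] is required, so this replaces
    the Neumann series away from the origin. *)
Lemma invariant_inverse (F : fieldType) N p q (S : 'M[F]_N) (B : 'M[F]_(p, N))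
    (D : 'M[F]_(N, q)) :
  (forall k, B *m S ^+ k *m D = 0) -> 1%:M - S \in unitmx ->
  B *m invmx (1%:M - S) *m D = 0.
Proof.
move=> h hu.
have [U [fU annU invU]] := span_family (fun t : nat * 'I_p => row t.2 (B *m S ^+ t.1)).
have UD : U *m D = 0 by apply: annU => -[k i] /=; rewrite -row_mul h row0.
have US : (U *m (1%:M - S) <= U)%MS.
  rewrite mulmxBr mulmx1 addmx_sub ?submx_refl // eqmx_opp invU // => -[k i] /=.
  by exists (k.+1, i); rewrite /= -row_mul -mulmxA exprSr mulmxE.
have UU : (U <= U *m (1%:M - S))%MS.
  have [_ <-] := mxrank_leqif_sup US.
  by rewrite mxrankMfree // row_free_unit.
have BU : (B <= U)%MS.
  by apply/row_subP => i; have := fU (0%N, i); rewrite /= expr0 mulmx1.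
have : (B *m invmx (1%:M - S) <= U)%MS.
  apply: (submx_trans (submxMr _ (submx_trans BU UU))).
  by rewrite mulmxK.
by case/submxP => Z ->; rewrite -mulmxA UD mulmx0.
Qed.

Lemma invmx_right (F : fieldType) n (A G : 'M[F]_n) :
  A *m G = 1%:M -> A \in unitmx /\ invmx A = G.
Proof.
move=> AG; have [uA _] := mulmx1_unit AG; split=> //.
by rewrite -[LHS]mulmx1 -AG mulKmx.
Qed.

(** * Minimal realizations are similar *)

Section Realizations.
Variables (R : realType) (g : nat).
Local Notation C := R[i].
Implicit Types r q : ratexpr R g.

Fixpoint words k : seq (seq 'I_g) :=
  if k is k'.+1 then [seq j :: w | j <- enum 'I_g, w <- words k'] else [:: [::]].

Lemma mem_words k w : (w \in words k) = (size w == k).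
Proof.
elim: k w => [|k IH] [|j w] //=.
  by apply/negbTE/negP => /allpairsP[[i u] [_ _]].
rewrite eqSS -IH; apply/allpairsP/idP => [[[i u] /= [_ hu [_ ->]]] // | hw].
by exists (j, w); rewrite mem_enum.
Qed.

Lemma words_uniq k : uniq (words k).
Proof.
elim: k => //= k IH; apply: allpairs_uniq => //; first exact: enum_uniq.
by move=> [i u] [j w] _ _ [-> ->].
Qed.

Lemma LambdaX_exp d (E : mxtuple R g d) n (X : mxtuple R g n) k :
  LambdaX E X ^+ k = \sum_(w <- words k) word_eval E w *t word_eval X w.
Proof.
elim: k => [|k IH]; first by rewrite big_seq1 !word_eval_nil tens11.
rewrite exprS IH big_allpairs_dep /= big_enum /= /LambdaX -mulmxE mulmx_suml.
apply: eq_bigr => j _; rewrite mulmx_sumr; apply: eq_bigr => w _.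
by rewrite tensmx_mul !word_eval_cons.
Qed.

(** The coefficient of the word [w] in the power series of [r] at the origin. *)
Definition coef r (w : seq 'I_g) : 'M[C]_1 :=
  adjmx (rc r) *m word_eval (@rE _ _ r) w *m rb r.

Lemma reval_term r n (X : mxtuple R g n) k :
  (adjmx (rc r) *t 1%:M) *m LambdaX (@rE _ _ r) X ^+ k *m (rb r *t 1%:M) =
  \sum_(w <- words k) coef r w *t word_eval X w.
Proof.
rewrite LambdaX_exp mulmx_sumr mulmx_suml; apply: eq_bigr => w _.
by rewrite !tensmx_mul mul1mx mulmx1.
Qed.

Lemma block_exp m n (M : 'M[C]_m) (N : 'M[C]_n) k :
  block_mx M 0 0 N ^+ k = block_mx (M ^+ k) 0 0 (N ^+ k).
Proof.
elim: k => [|k IH]; first by rewrite !expr0 -scalar_mx_block.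
by rewrite !exprS IH -!mulmxE mulmx_block !mulmx0 !mul0mx !addr0 add0r.
Qed.

(** The difference of the two values is an expression [B (1 - S)^-1 D] for the direct
    sum [S] of the two pencils, and equality of coefficients says [B S^k D = 0] for
    all [k]. *)
Lemma coef_same_ratfun r q : (forall w, coef r w = coef q w) -> same_ratfun r q.
Proof.
move=> h n X hr hq.
have ur : rpencil r X \in unitmx by rewrite unitmxE unitfE.
have uq : rpencil q X \in unitmx by rewrite unitmxE unitfE.
set M := LambdaX (@rE _ _ r) X; set N := LambdaX (@rE _ _ q) X.
pose S := block_mx M 0 0 N.
pose G := block_mx (invmx (rpencil r X)) 0 0 (invmx (rpencil q X)).
have SG : (1%:M - S) *m G = 1%:M.
  rewrite /S /G scalar_mx_block opp_block_mx add_block_mx !oppr0 !addr0.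
  by rewrite mulmx_block !mulmx0 !mul0mx !addr0 add0r !mulmxV // -scalar_mx_block.
have [uS iS] := invmx_right SG.
have := @invariant_inverse _ _ _ _ S (row_mx (adjmx (rc r) *t 1%:M) (- (adjmx (rc q) *t 1%:M)))
  (col_mx (rb r *t 1%:M) (rb q *t 1%:M)).
rewrite iS => /(_ _ uS); rewrite !mul_row_block !mulmx0 !add0r !addr0 mul_row_col.
rewrite !mulNmx => hG; apply/eqP; rewrite -subr_eq0; apply/eqP; apply: hG => k.
rewrite block_exp mul_row_block !mulmx0 !add0r !addr0 mul_row_col !mulNmx !reval_term.
by apply/eqP; rewrite subr_eq0; apply/eqP/eq_bigr => w _; rewrite h.
Qed.

(** Shift matrices that can only be multiplied along the letters of [w]: their
    product over a word [u] reaches the corner entry exactly when [u = w]. *)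
Definition shift_tuple (w : seq 'I_g) : mxtuple R g (size w).+1 :=
  fun j => \matrix_(a, b) ((b == a.+1 :> nat) && (onth w a == Some j))%:R.

Lemma shift_word w u a b :
  word_eval (shift_tuple w) u a b = ((b == a + size u :> nat)%N && prefix u (drop a w))%:R.
Proof.
elim: u a => [|j u IH] a.
  by rewrite word_eval_nil mxE addn0 prefix0s andbT eq_sym.
rewrite word_eval_cons mxE /=.
have [aw|aw] := ltnP a (size w); last first.
  rewrite drop_oversize // andbF big1 // => c _; rewrite mxE onth_default // andbF.
  by rewrite mul0r.
have aw' : (a.+1 < (size w).+1)%N by [].
rewrite (bigD1 (Ordinal aw')) //= big1 ?addr0; last first.
  move=> c hc; rewrite mxE; case: eqP => [e|_]; last by rewrite mul0r.
  by case/eqP: hc; apply: val_inj.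
rewrite mxE IH eqxx /= addSnnS (drop_nth j aw) prefix_cons.
by rewrite onthE (nth_map j) // -natrM mulnb [_ == Some j]eq_sym andbCA.
Qed.

(** At [shift_tuple w] every linear pencil is nilpotent, so both realizations are
    defined and given by a finite Neumann series, whose corner entry is the coefficient
    of [w]. *)
Lemma same_ratfun_coef r q : same_ratfun r q -> forall w, coef r w = coef q w.
Proof.
move=> h w; set X := shift_tuple w.
have nil p : LambdaX (@rE _ _ p) X ^+ (size w).+1 = 0.
  rewrite LambdaX_exp big_seq big1 // => u; rewrite mem_words => /eqP su.
  rewrite [word_eval X u](_ : _ = 0) ?tensmx0 //; apply/matrixP => a b.
  rewrite shift_word mxE su; case: eqP => //= e.
  by have := ltn_ord b; rewrite e ltnNge leq_addl.
pose G p := \sum_(i < (size w).+1) LambdaX (@rE _ _ p) X ^+ i.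
have SG p : rpencil p X *m G p = 1%:M.
  have := subrX1 (LambdaX (@rE _ _ p) X) (size w).+1; rewrite nil sub0r => /(congr1 -%R).
  by rewrite opprK -mulNr opprB.
have uS p := invmx_right (SG p).
have rE p : reval p X (mxtens_index (0, 0)) (mxtens_index (0, ord_max)) = coef p w 0 0.
  rewrite /reval (uS p).2 /G mulmx_sumr mulmx_suml summxE.
  have E u : (coef p u *t word_eval X u) (mxtens_index (0, 0)) (mxtens_index (0, ord_max)) =
      coef p u 0 0 * (u == w)%:R.
    rewrite tensmxE shift_word /= add0n drop0 prefixE; congr (_ * _%:R); congr nat_of_bool.
    apply/andP/eqP => [[/eqP s /eqP <-]|->]; first by rewrite -s take_size.
    by rewrite take_size.
  rewrite big_ord_recr /= big1 => [|i _]; last first.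
    rewrite reval_term summxE big_seq big1 // => u; rewrite mem_words => /eqP su.
    rewrite E; case: eqP => [uw|]; last by rewrite mulr0.
    by have := ltn_ord i; rewrite -su uw ltnn.
  rewrite add0r reval_term summxE (bigD1_seq w) ?words_uniq ?mem_words //=.
  rewrite E eqxx mulr1 big1 ?addr0 // => u uw; by rewrite E (negPf uw) mulr0.
have dp p : \det (rpencil p X) != 0 by rewrite -unitfE -unitmxE; case: (uS p).
by apply/matrixP => i j; rewrite !ord1 -!rE h.
Qed.

(** [T] need not be invertible, so that this also covers passing to an invariant
    subspace or to a quotient. *)
Lemma intertwine_coef r q (T : 'M[C]_(rdim r, rdim q)) :
  (forall j, @rE _ _ r j *m T = T *m @rE _ _ q j) -> rb r = T *m rb q ->
  adjmx (rc q) = adjmx (rc r) *m T -> forall w, coef r w = coef q w.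
Proof.
move=> hE hb hc w; rewrite /coef hb hc.
suff -> : adjmx (rc r) *m T *m word_eval (@rE _ _ q) w = 
   adjmx (rc r) *m (word_eval (@rE _ _ r) w *m T) by rewrite !mulmxA.
rewrite -mulmxA; congr (_ *m _); elim: w => [|j w IH].
  by rewrite !word_eval_nil mulmx1 mul1mx.
by rewrite !word_eval_cons mulmxA -hE -mulmxA IH mulmxA.
Qed.

Lemma minimal_rdim r q q' : minimal_realization r q ->
  (forall w, coef q w = coef q' w) -> (rdim q <= rdim q')%N.
Proof.
move=> [rq min] h; apply: min; apply: coef_same_ratfun => w.
by rewrite (same_ratfun_coef rq).
Qed.

(** The vectors [E^w b] span an invariant subspace containing [b]; restricting the
    realization to it keeps the coefficients, so by minimality it is the whole space.
    The spans are taken among row vectors, whence the transpositions. *)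
Lemma minimal_controllable r q : minimal_realization r q ->
  forall k (M : 'M[C]_(k, rdim q)),
  (forall w, M *m (word_eval (@rE _ _ q) w *m rb q) = 0) -> M = 0.
Proof.
move=> hq k M hM.
have [U [fU annU invU]] := span_family (fun w => (word_eval (@rE _ _ q) w *m rb q)^T).
pose P := row_base U.
have PE j : (P *m (@rE _ _ q j)^T <= P)%MS.
  have h : (U *m (@rE _ _ q j)^T <= U)%MS.
    by apply: invU => w; exists (j :: w); rewrite -trmx_mul mulmxA word_eval_cons.
  by rewrite eq_row_base; apply: submx_trans h; apply: submxMr; rewrite eq_row_base.
have bP : ((rb q)^T <= P)%MS.
  by rewrite eq_row_base; have := fU [::]; rewrite word_eval_nil mul1mx.
pose q' : ratexpr R g := @RatExpr _ _ (\rank U)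
  (fun j => (P *m (@rE _ _ q j)^T *m pinvmx P)^T) ((rb q)^T *m pinvmx P)^T
  (adjmx (adjmx (rc q) *m P^T)).
have le : (rdim q <= rdim q')%N.
  apply: (minimal_rdim hq); apply: (@intertwine_coef q q' P^T) => /=.
  - by move=> j; rewrite -trmx_mul (mulmxKpV (PE j)) (trmx_mul P) trmxK.
  - by rewrite -trmx_mul (mulmxKpV bP) trmxK.
  by rewrite adjmxK.
have fullU : row_full U by rewrite -col_leq_rank.
have : U *m M^T = 0.
  by apply: annU => w; rewrite -trmx_mul hM trmx0.
move/(congr1 (mulmx (pinvmx U))); rewrite mulmxA mulVpmx // mul1mx mulmx0 => h.
by apply: trmx_inj; rewrite h trmx0.
Qed.

Lemma word_eval_cat n (X : mxtuple R g n) u w :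
  word_eval X (u ++ w) = word_eval X u *m word_eval X w.
Proof. by rewrite /word_eval big_cat mulmxE. Qed.

(** Dually, restricting to the span of the rows [c^* E^w] amounts to dividing by the
    vectors they all annihilate, and keeps the coefficients. *)
Lemma minimal_observable r q : minimal_realization r q ->
  forall k (M : 'M[C]_(rdim q, k)),
  (forall w, adjmx (rc q) *m word_eval (@rE _ _ q) w *m M = 0) -> M = 0.
Proof.
move=> hq k M hM.
have [U [fU annU invU]] := span_family (fun w => adjmx (rc q) *m word_eval (@rE _ _ q) w).
pose P := row_base U.
have PE j : (P *m @rE _ _ q j <= P)%MS.
  have h : (U *m @rE _ _ q j <= U)%MS.
    apply: invU => w; exists (w ++ [:: j]).
    by rewrite word_eval_cat word_eval_cons word_eval_nil mulmx1 mulmxA.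
  by rewrite eq_row_base; apply: submx_trans h; apply: submxMr; rewrite eq_row_base.
have cP : (adjmx (rc q) <= P)%MS.
  by rewrite eq_row_base; have := fU [::]; rewrite word_eval_nil mulmx1.
pose q' : ratexpr R g := @RatExpr _ _ (\rank U)
  (fun j => P *m @rE _ _ q j *m pinvmx P) (P *m rb q) (adjmx (adjmx (rc q) *m pinvmx P)).
have le : (rdim q <= rdim q')%N.
  apply: (minimal_rdim hq) => w; apply/esym; apply: (@intertwine_coef q' q P) => //=.
  - by move=> j; rewrite (mulmxKpV (PE j)).
  by rewrite adjmxK (mulmxKpV cP).
have fullU : row_full U by rewrite -col_leq_rank.
have : U *m M = 0 by apply: annU.
by move/(congr1 (mulmx (pinvmx U))); rewrite mulmxA mulVpmx // mul1mx mulmx0.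
Qed.

(** In the direct sum of the two state spaces, the span of the pairs
    [(E^w b, E'^w b')] is the graph of a linear map: its first projection is onto by
    controllability of [q], and a pair [(0, x')] in it satisfies [c'^* E'^w x' = 0] for
    all [w], the coefficients being equal, so [x' = 0] by observability of [q']. *)
Lemma minimal_transfer r q q' : minimal_realization r q -> minimal_realization r q' ->
  exists T : 'M[C]_(rdim q', rdim q), forall w,
    word_eval (@rE _ _ q') w *m rb q' = T *m (word_eval (@rE _ _ q) w *m rb q).
Proof.
move=> hq hq'; have eqc w : coef q w = coef q' w.
  by rewrite -(same_ratfun_coef hq.1) (same_ratfun_coef hq'.1).
pose x (p : ratexpr R g) w := word_eval (@rE _ _ p) w *m rb p.
have [U [fU annU _]] := span_family (fun w => row_mx (x q w)^T (x q' w)^T).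
pose U1 := lsubmx U; pose U2 := rsubmx U.
have UE : U = row_mx U1 U2 by rewrite hsubmxK.
have fD w : exists D : 'rV_(rdim q + rdim q'), (x q w)^T = D *m U1 /\ (x q' w)^T = D *m U2.
  case/submxP: (fU w) => D; rewrite {1}UE mul_mx_row => /eq_row_mx[h1 h2].
  by exists D.
have full1 : row_full U1.
  rewrite -cokermx_eq0; apply/eqP; apply: trmx_inj; rewrite trmx0.
  apply: (minimal_controllable hq) => w; apply: trmx_inj.
  have [D [h _]] := fD w.
  by rewrite trmx_mul trmxK -/(x q w) h -mulmxA mulmx_coker mulmx0 trmx0.
have ker p (Y : 'M_(p, _)) : Y *m U1 = 0 -> Y *m U2 = 0.
  move=> YU1; apply: trmx_inj; rewrite trmx0; apply: (minimal_observable hq') => w.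
  pose cw (s : ratexpr R g) w := adjmx (rc s) *m word_eval (@rE _ _ s) w.
  have : U *m col_mx (cw q w)^T (- (cw q' w)^T) = 0.
    apply: annU => v; rewrite mul_row_col mulmxN -!trmx_mul.
    apply/eqP; rewrite subr_eq0; apply/eqP; congr trmx.
    by have := eqc (w ++ v); rewrite /coef !word_eval_cat /cw /x !mulmxA.
  rewrite UE mul_row_col mulmxN => /eqP; rewrite subr_eq0 => /eqP h.
  by apply: trmx_inj; rewrite [LHS]trmx_mul (trmxK (Y *m U2)) trmx0 -mulmxA -h mulmxA YU1 mul0mx.
exists (pinvmx U1 *m U2)^T => w; have [D [h1 h2]] := fD w.
apply: trmx_inj; rewrite -/(x q w) -/(x q' w) [RHS]trmx_mul (trmxK (pinvmx U1 *m U2)) h1 h2.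
have e0 : (U1 *m pinvmx U1 - 1%:M) *m U1 = 0.
  by rewrite mulmxBl mul1mx -(mulmxA U1) (mulVpmx full1) mulmx1 subrr.
have /eqP := ker _ _ e0; rewrite mulmxBl mul1mx subr_eq0 => /eqP.
by rewrite -!mulmxA => ->.
Qed.

(** The state space isomorphism theorem.  Two transfer maps in opposite directions
    are mutually inverse because they are so on the vectors [E^w b], which span. *)
Lemma minimal_similar r q q' : minimal_realization r q -> minimal_realization r q' ->
  exists (T : 'M[C]_(rdim q', rdim q)) (T' : 'M[C]_(rdim q, rdim q')),
  [/\ T *m T' = 1%:M, T' *m T = 1%:M, forall j, @rE _ _ q' j *m T = T *m @rE _ _ q j,
      rb q' = T *m rb q & adjmx (rc q) = adjmx (rc q') *m T].
Proof.
move=> hq hq'; have eqc w : coef q w = coef q' w.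
  by rewrite -(same_ratfun_coef hq.1) (same_ratfun_coef hq'.1).
have [T hT] := minimal_transfer hq hq'; have [T' hT'] := minimal_transfer hq' hq.
exists T, T'; split.
- apply/eqP; rewrite -subr_eq0; apply/eqP; apply: (minimal_controllable hq') => w.
  by rewrite mulmxBl mul1mx -mulmxA -hT' -hT subrr.
- apply/eqP; rewrite -subr_eq0; apply/eqP; apply: (minimal_controllable hq) => w.
  by rewrite mulmxBl mul1mx -mulmxA -hT -hT' subrr.
- move=> j; apply/eqP; rewrite -subr_eq0; apply/eqP; apply: (minimal_controllable hq) => w.
  have := hT (j :: w); rewrite !word_eval_cons -!mulmxA hT => h.
  by rewrite mulmxBl -!mulmxA h subrr.
- by have := hT [::]; rewrite !word_eval_nil !mul1mx.
apply/eqP; rewrite -subr_eq0; apply/eqP; apply: (minimal_controllable hq) => w.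
rewrite mulmxBl -[_ *m T *m _]mulmxA -hT !mulmxA -[X in X - _]/(coef q w) eqc.
by rewrite subrr.
Qed.

(** Similar pencils are singular at the same points and, where they are not, give
    the same value: it is enough to study one minimal realization. *)
Lemma minimal_eval r q q' n (X : mxtuple R g n) :
  minimal_realization r q -> minimal_realization r q' -> rpencil q X \in unitmx ->
  rpencil q' X \in unitmx /\ reval q' X = reval q X.
Proof.
move=> hq hq' hu; have [T [T' [TT T'T hE hb hc]]] := minimal_similar hq hq'.
pose G := (T *t 1%:M) *m invmx (rpencil q X) *m (T' *t (1%:M : 'M_n)).
have comm : rpencil q' X *m (T *t 1%:M) = (T *t 1%:M) *m rpencil q X.
  rewrite /rpencil mulmxBl mulmxBr mul1mx mulmx1; congr (_ - _).
  rewrite /LambdaX mulmx_suml mulmx_sumr; apply: eq_bigr => j _.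
  by rewrite !tensmx_mul hE mul1mx mulmx1.
have PG : rpencil q' X *m G = 1%:M.
  by rewrite /G !mulmxA comm mulmxK // tensmx_mul TT mulmx1 tens11.
have [hu' iq'] := invmx_right PG.
split=> //; rewrite /reval iq'.
rewrite /G -!mulmxA tensmx_mul mulmx1 hb [T' *m _]mulmxA T'T mul1mx !mulmxA.
by rewrite tensmx_mul -hc mulmx1.
Qed.

End Realizations.

(** * Rational functions analytic on a spectrahedron *)

Section RationalFunctions.
Variables (R : realType) (g d : nat) (A : mxtuple R g d).
Hypothesis hA : free_bounded (spectrahedron A).

Lemma rational_analytic_margin (p : ratexpr R g) : analytic_on p (spectrahedron A) ->
  exists t : R, 1 < t /\ analytic_on p (free_scale t (spectrahedron A)) /\
     rat_bounded_on p (free_scale t (spectrahedron A)).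
Proof.
move=> hp; have [q hq] := minimal_realization_exists p.
have [|t [e [t1 e0 he]]] := pencil_uniform hA (q := q).
  by move=> n X hX; apply/eqP => h; apply: (hp _ _ hX); exists q.
have hu n (X : mxtuple R g n) hX := pencil_unit e0 (he n X hX).
exists t; split=> //; split.
  move=> n X hX [q' hq' h].
  by have [] := minimal_eval hq hq' (hu _ _ hX); rewrite unitmxE h unitr0.
have [B hB] := reval_bound q e0; exists B => q' hq' n X hX.
have [_ ->] := minimal_eval hq hq' (hu _ _ hX).
by apply: hB; apply: he.
Qed.
End RationalFunctions.

Theorem proposition1p7 (R : realType) (g d : nat) (A : 'I_g -> 'M[R[i]]_d)
  (hA : free_bounded (spectrahedron A)) :
  (forall t : R, 1 < t ->
     exists (k l : nat) (Q : freepoly R g k l),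
       free_subset (spectrahedron A) (pseudoconvex Q) /\
       free_subset (pseudoconvex Q) (free_scale t (spectrahedron A)))
  /\
  (forall (k l : nat) (Q : freepoly R g k l),
     free_subset (spectrahedron A) (pseudoconvex Q) ->
     exists s : R, 1 < s /\ free_subset (spectrahedron A) (Kset s Q))
  /\
  (forall p : ratexpr R g, analytic_on p (spectrahedron A) ->
     exists t : R, 1 < t /\
       analytic_on p (free_scale t (spectrahedron A)) /\
       rat_bounded_on p (free_scale t (spectrahedron A))).
Proof.
split; first exact: pseudoconvex_between hA.
by split; [exact: pseudoconvex_margin hA | exact: rational_analytic_margin hA].
Qed.
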